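(* Let $1<p<2$ and let $\mu=Ce^{-\frac1p\|x\|_p^p}dx$ be a probability measure on $\mathbb{R}^n$ (with $C>0$ the normalizing constant); put $V(x)=\frac1p\|x\|_p^p$. Then the best value of $\lambda$ in the inequality $$\mathrm{Var}_\mu f\le\lambda\int_{\mathbb{R}^n}\langle(D^2V)^{-1}\nabla f,\nabla f\rangle\,d\mu,$$ considered on the set of even functions $f$, satisfies $\lambda>1-\frac1p$. In particular, the inequality $$\int_{\mathbb{R}^n} e^{-\Phi(x)}\,dx\,\Bigl(\int_{\mathbb{R}^n} e^{-\frac{1}{p-1}\Phi^*(\nabla V(x))}\,dx\Bigr)^{p-1}\le\Bigl(\int_{\mathbb{R}^n} e^{-V(x)}\,dx\Bigr)^p,$$ stated for arbitrary proper convex even functions $\Phi$ on $\mathbb{R}^n$ with values in $(-\infty,+\infty]$, fails to hold in this case.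
   Context: $\|x\|_p=\bigl(\sum_{i=1}^n|x_i|^p\bigr)^{1/p}$. $\mathrm{Var}_\mu f=\int f^2d\mu-\bigl(\int f\,d\mu\bigr)^2$. $D^2V$ is the Hessian of $V$. $\Phi^*(y)=\sup_{x\in\mathbb{R}^n}(\langle x,y\rangle-\Phi(x))$ is the Legendre transform. A convex function is proper if it is not identically $+\infty$. A function $f$ is even if $f(-x)=f(x)$. The best value of $\lambda$ is the smallest one for which the first inequality holds on the set of even functions.
   Formalization: The dimension is assumed to be n ≥ 2; for n = 1 the claim is false, since the best λ on even functions is exactly 1 − 1/p (attained at f = V) and the integral inequality holds for even convex Φ. *)

(* Defs.v *)
From HB Require Import structures.
From mathcomp Require Import all_boot all_order all_algebra.
From mathcomp Require Import all_classical all_reals all_analysis.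

Set Implicit Arguments.
Unset Strict Implicit.
Unset Printing Implicit Defensive.

Import Order.TTheory GRing.Theory Num.Theory.
Import numFieldNormedType.Exports.

Local Open Scope classical_set_scope.
Local Open Scope ring_scope.

Fact rV_display : measure_display.
Proof. exact: default_measure_display. Qed.

Definition rV_coord (R : realType) (n : nat) (i : 'I_n) (x : 'rV[R]_n) :
  measurableTypeR R := x 0 i.

(* Points of R^n are row vectors. As for n.-tuple T in the library, the
   sigma-algebra on 'rV[R]_n is the one generated by the coordinate maps, that
   is, the Borel sigma-algebra of R^n. *)
Section measurable_rV.
Context (R : realType) (n : nat).

Let coords := @rV_coord R n.

Let rV_set0 : g_sigma_preimage coords set0.
Proof. exact: sigma_algebra0. Qed.

Let rV_setC A : g_sigma_preimage coords A -> g_sigma_preimage coords (~` A).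
Proof. exact: sigma_algebraC. Qed.

Let rV_bigcup (F : _^nat) : (forall i, g_sigma_preimage coords (F i)) ->
  g_sigma_preimage coords (\bigcup_i (F i)).
Proof. exact: sigma_algebra_bigcup. Qed.

HB.instance Definition _ := @isMeasurable.Build rV_display 'rV[R]_n
  (g_sigma_preimage coords) rV_set0 rV_setC rV_bigcup.

End measurable_rV.

Section lebesgue_rV.
Context (R : realType).

Definition rV_cons n (z : measurableTypeR R * 'rV[R]_n) : 'rV[R]_n.+1 :=
  \row_i if unlift ord0 i is Some j then z.2 0 j else z.1.

Lemma measurable_rV_coord n (i : 'I_n) :
  measurable_fun [set: 'rV[R]_n] (@rV_coord R n i).
Proof.
move=> _ Y mY; rewrite setTI; apply: sub_sigma_algebra => /=.
rewrite -bigcup_seq/=; exists i => /=; first by rewrite mem_index_enum.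
by exists Y => //; rewrite setTI.
Qed.

Lemma measurable_fun_rVP d (T : measurableType d) n (f : T -> 'rV[R]_n) :
  (forall i, measurable_fun [set: T] (@rV_coord R n i \o f)) ->
  measurable_fun [set: T] f.
Proof.
move=> mf.
suff H : g_sigma_preimage (fun i => @rV_coord R n i \o f) `<=` measurable.
  move: H; rewrite g_sigma_preimage_comp => H _ A mA.
  by apply: H; exists A.
apply: smallest_sub; first exact: sigma_algebra_measurable.
case: n => [|n] in f mf *; first by rewrite big_ord0.
rewrite -bigcup_mkord_ord; apply: bigcup_sub => i Ii.
by move=> A [B mB <-]; exact: mf.
Qed.

Lemma measurable_rV_cons n : measurable_fun setT (@rV_cons n).
Proof.
apply: measurable_fun_rVP => i.
rewrite (_ : _ \o _ = fun z : measurableTypeR R * 'rV[R]_n =>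
    if unlift ord0 i is Some j then rV_coord j z.2 else z.1); last first.
  by apply/funext => z /=; rewrite /rV_coord mxE.
case: (unlift ord0 i) => [j|]; last exact: measurable_fst.
by apply: (measurableT_comp (measurable_rV_coord j)); exact: measurable_snd.
Qed.

Definition rV_uncons n (x : 'rV[R]_n.+1) : measurableTypeR R * 'rV[R]_n :=
  (x 0 ord0, \row_j x 0 (lift ord0 j)).

Lemma rV_consK n : cancel (@rV_cons n) (@rV_uncons n).
Proof.
move=> [a v]; rewrite /rV_uncons mxE unlift_none; congr pair.
by apply/rowP => j; rewrite !mxE liftK.
Qed.

Lemma measurable_rV_uncons n : measurable_fun setT (@rV_uncons n).
Proof.
apply/measurable_fun_pairP; split; first exact: (measurable_rV_coord ord0).
apply: measurable_fun_rVP => i.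
rewrite (_ : _ \o _ = @rV_coord R n.+1 (lift ord0 i)).
  exact: measurable_rV_coord.
by apply/funext => x /=; rewrite /rV_coord mxE.
Qed.

Section cons_measure.
Context (n : nat) (m : {sigma_finite_measure set 'rV[R]_n -> \bar R}).

Definition cons_measure : set 'rV[R]_n.+1 -> \bar R :=
  pushforward (lebesgue_measure \x m)%E (@rV_cons n).

Let cons_measure0 : cons_measure set0 = 0%E.
Proof. by rewrite /cons_measure /pushforward preimage_set0 measure0. Qed.

Let cons_measure_ge0 A : (0 <= cons_measure A)%E.
Proof. exact: (@measure_ge0 _ _ _ (lebesgue_measure \x m)%E). Qed.

Let cons_measure_sigma_additive : semi_sigma_additive cons_measure.
Proof.
move=> F mF tF mUF; rewrite /cons_measure /pushforward preimage_bigcup.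
have mc A : measurable A -> measurable (@rV_cons n @^-1` A).
  by move=> mA; rewrite -[X in measurable X]setTI; exact: measurable_rV_cons.
apply: measure_semi_sigma_additive.
- by move=> k; exact: mc.
- apply/trivIsetP => /= i j _ _ ij; rewrite -preimage_setI.
  by move/trivIsetP : tF => /(_ _ _ _ _ ij) ->//; rewrite preimage_set0.
- by rewrite -preimage_bigcup; exact: mc.
Qed.

HB.instance Definition _ := isMeasure.Build _ _ _ cons_measure
  cons_measure0 cons_measure_ge0 cons_measure_sigma_additive.

Let cons_measure_sigma_finite : sigma_finite setT cons_measure.
Proof.
have /sigma_finiteP[F [TF ndF Foo]] := sigma_finiteT (@lebesgue_measure R).
have /sigma_finiteP[G [TG ndG Goo]] := sigma_finiteT m.
exists (fun k => @rV_uncons n @^-1` (F k `*` G k)).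
  rewrite -preimage_bigcup (_ : \bigcup_k _ = setT) ?preimage_setT//.
  apply/seteqP; split => // -[a v] _.
  have [i _ Fia] : (\bigcup_k F k) a by rewrite -TF.
  have [j _ Gjv] : (\bigcup_k G k) v by rewrite -TG.
  exists (maxn i j) => //; split.
  - by move: a Fia; exact/subsetPset/ndF/leq_maxl.
  - by move: v Gjv; exact/subsetPset/ndG/leq_maxr.
move=> k; have [mF Fk] := Foo k; have [mG Gk] := Goo k; split.
  by rewrite -[X in measurable X]setTI; apply: measurable_rV_uncons => //;
    exact: measurableX.
rewrite /cons_measure /pushforward -comp_preimage.
rewrite (_ : _ \o _ = id) ?preimage_id; last first.
  by apply/funext => z /=; rewrite rV_consK.
by rewrite product_measure1E// lte_mul_pinfty// ge0_fin_numE.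
Qed.

HB.instance Definition _ := Measure_isSigmaFinite.Build _ _ _ cons_measure
  cons_measure_sigma_finite.

End cons_measure.

(* Lebesgue measure on R^n as an n-fold product: the unit point mass for n = 0,
   and the image of lebesgue_measure \x (Lebesgue measure on R^n) under the
   identification of R * R^n with R^(n+1). *)
Fixpoint lebesgue_rV n : {sigma_finite_measure set 'rV[R]_n -> \bar R} :=
  match n return {sigma_finite_measure set 'rV[R]_n -> \bar R} with
  | 0 => dirac (0 : 'rV[R]_0)
  | n'.+1 => cons_measure (lebesgue_rV n')
  end.

Lemma lebesgue_rV_box n (A : 'I_n -> set (measurableTypeR R)) :
  (forall i, measurable (A i)) ->
  lebesgue_rV n [set x : 'rV[R]_n | forall i, A i (x 0 i)] =
  (\prod_(i < n) lebesgue_measure (A i))%E.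
Proof.
elim: n => [|n IHn] in A *; move=> mA.
  by rewrite big_ord0 /= diracE mem_set// => -[].
rewrite big_ord_recl -(IHn (fun i => A (lift ord0 i)))//.
rewrite [LHS]/= /cons_measure /pushforward.
rewrite -product_measure1E//; last first.
  rewrite (_ : mkset _ = \bigcap_(i in [set: 'I_n])
      (@rV_coord R n i @^-1` A (lift ord0 i))); last first.
    by apply/seteqP; split => x /= xA i; [move=> _|]; apply: xA.
  apply: fin_bigcap_measurable => // i _.
  by rewrite -[X in measurable X]setTI; exact: measurable_rV_coord.
congr (product_measure1 _ _ _); apply/seteqP; split => -[a v] /=.
  move=> H; split => [|i]; first by have := H ord0; rewrite mxE unlift_none.
  by have := H (lift ord0 i); rewrite mxE liftK.
by move=> [Aa Av] i; rewrite mxE; case: unliftP => [j ->|->].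
Qed.

End lebesgue_rV.

Section functions_on_rV.
Context (R : realType) (n : nat).
Implicit Types (x y : 'rV[R]_n) (f : 'rV[R]_n -> R) (Phi : 'rV[R]_n -> \bar R).

Definition dotr x y : R := \sum_(i < n) x 0 i * y 0 i.

Definition lpnorm (p : R) x : R := (\sum_(i < n) `|x 0 i| `^ p) `^ p^-1.

Definition lp_potential (p : R) x : R := p^-1 * lpnorm p x `^ p.

Definition grad f x : 'rV[R]_n := \row_i 'D_(delta_mx 0 i) f x.

Definition hessian f x : 'M[R]_n :=
  \matrix_(i, j) 'D_(delta_mx 0 i) ('D_(delta_mx 0 j) f) x.

Definition even_fun (T : Type) (g : 'rV[R]_n -> T) := forall x, g (- x) = g x.

Definition C1_fun f := (forall x, differentiable f x) /\ continuous (grad f).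

Definition proper_fun Phi :=
  (forall x, Phi x != -oo%E) /\ (exists x, Phi x != +oo%E).

Definition econvex_fun Phi := forall x y (t : R), 0 <= t <= 1 ->
  (Phi (t *: x + (1 - t) *: y)%R <= t%:E * Phi x + (1 - t)%:E * Phi y)%E.

Definition legendre Phi y : \bar R :=
  ereal_sup [set ((dotr x y)%:E - Phi x)%E | x in [set: 'rV[R]_n]].

End functions_on_rV.

Section brascamp_lieb.
Context (R : realType) (n : nat).
Variables (V : 'rV[R]_n -> R) (mu : {measure set 'rV[R]_n -> \bar R}).

Definition Var (f : 'rV[R]_n -> R) : \bar R :=
  (\int[mu]_x (f x ^+ 2)%:E - (\int[mu]_x (f x)%:E) ^+ 2)%E.

(* Row-vector convention: a symmetric matrix A acts by v |-> v *m A. For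
   V = lp_potential p with p < 2 the Hessian exists and is invertible exactly
   off the coordinate hyperplanes; the arbitrary value that the total operators
   give to the integrand on these hyperplanes does not affect the integral. *)
Definition BL_energy (f : 'rV[R]_n -> R) : \bar R :=
  (\int[mu]_x (dotr (grad f x *m invmx (hessian V x)) (grad f x))%:E)%E.

Definition even_BL_holds (lambda : R) := forall f : 'rV[R]_n -> R,
  C1_fun f -> even_fun f -> f \in Lfun mu 2%:E ->
  (Var f <= lambda%:E * BL_energy f)%E.

(* The smallest lambda for which the inequality holds, as an extended real:
   +oo stands for the absence of such a lambda. *)
Definition best_even_BL : \bar R :=
  ereal_inf [set lambda%:E | lambda in even_BL_holds].

End brascamp_lieb.

Definition santalo_ineq (R : realType) (n : nat) (p : R) (V : 'rV[R]_n -> R)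
    (Phi : 'rV[R]_n -> \bar R) : Prop :=
  ((\int[lebesgue_rV R n]_x expeR (- Phi x)) *
   poweR (\int[lebesgue_rV R n]_x
            expeR (- ((p - 1)^-1%:E * legendre Phi (grad V x)))) (p - 1) <=
   poweR (\int[lebesgue_rV R n]_x (expR (- V x))%:E) p)%E.

(* Main.v *)
Require Import Defs.
From mathcomp Require Import all_boot all_order all_algebra.
From mathcomp Require Import all_classical all_reals all_analysis.
From mathcomp Require Import measurable_realfun measurable_fun_approximation.
From mathcomp Require Import ring lra.

Set Implicit Arguments.
Unset Strict Implicit.
Unset Printing Implicit Defensive.

Import Order.TTheory GRing.Theory Num.Theory.
Import numFieldNormedType.Exports.

Local Open Scope classical_set_scope.
Local Open Scope ring_scope.

(* For the first claim, test the inequality with f(x) = x_1 x_2. With M(s) the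
   integral of |t|^s exp(-|t|^p/p) over the line, Var f is proportional to M(2)^2
   and the energy, with the same factor, to 2 M(2) M(2-p) / (p-1). Integration by
   parts gives M(s+p) = (s+1) M(s), so M(2) = (3-p) M(2-p) and the best constant
   is at least (3-p)(p-1)/2, which exceeds 1 - 1/p since p(3-p) > 2 on ]1, 2[.

   For the second claim, let Phi be the indicator of the long tube of length N
   around the diagonal x_1 = x_2. The volume of the tube is of order N. Its
   support function is bounded on the slab |y_1 + y_2| <= 1/N, |y_i| <= 1, whose
   preimage under the gradient of V has volume at least of order 1/N. Hence the
   left-hand side is at least of order N^(2-p), which is unbounded. *)

(** * Integrals of nonnegative functions: comparison and densities *)

Section integral_complements.
Context d (T : measurableType d) (R : realType).
Implicit Type mu : {measure set T -> \bar R}.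
Local Open Scope ereal_scope.

Import HBNNSimple.

(** The integral of a nonnegative function is the supremum over the simple functions below it, and a
    simple function below [f] is below [g]. This form covers integrands whose measurability is not
    established, such as those built from a Hessian or a Legendre transform. *)
Lemma ge0_le_integral_nonmeasurable mu (f g : T -> \bar R) :
  (forall x, 0 <= f x) -> (forall x, f x <= g x) ->
  \int[mu]_x f x <= \int[mu]_x g x.
Proof.
move=> f0 fg; rewrite !ge0_integralTE//; last by move=> x; exact: le_trans (fg x).
apply: ge_ereal_sup => _ [h /= hf <-]; apply: ereal_sup_ubound.
by exists h => //= x; exact: le_trans (fg x).
Qed.

(** Raising [g] to +oo on the null set [N] keeps its integral and makes it dominate [f] everywhere.
    It is meant for the energy integrand, whose values on the coordinate hyperplanes are
    arbitrary. *)
Lemma ge0_le_integral_off_null mu (f g : T -> \bar R) (N : set T) :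
  measurable N -> mu N = 0 -> measurable_fun [set: T] g ->
  (forall x, 0 <= f x) -> (forall x, 0 <= g x) ->
  (forall x, ~ N x -> f x <= g x) ->
  \int[mu]_x f x <= \int[mu]_x g x.
Proof.
move=> mN N0 mg f0 g0 fg.
pose h x := if x \in N then +oo else g x.
have mh : measurable_fun [set: T] h.
  apply: measurable_fun_if => //.
  - apply: (measurable_fun_bool true); rewrite setTI (_ : _ @^-1` _ = N)//.
    by apply/seteqP; split => x /=; [move/set_mem|move=> Nx; rewrite mem_set].
  - exact: measurable_funTS.
have h0 x : 0 <= h x by rewrite /h; case: ifP.
rewrite [leRHS](_ : _ = \int[mu]_x h x); last first.
  rewrite (ge0_negligible_integral mN _ mg _ N0)//.
  rewrite [RHS](ge0_negligible_integral mN _ mh _ N0)//.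
  apply: eq_integral => x; rewrite in_setD => /andP[_ xN].
  by rewrite /h (negbTE xN).
apply: ge0_le_integral_nonmeasurable => // x; rewrite /h.
by case: ifPn; [rewrite leey|rewrite notin_setE => /fg].
Qed.

(** Markov's bound, from comparison with [c] times the indicator of [A]; it turns volumes into lower
    bounds, also for an integrand containing a Legendre transform. *)
Lemma ge0_measure_le_integral mu (f : T -> \bar R) (A : set T) (c : R) :
  measurable A -> (0 <= c)%R -> (forall x, 0 <= f x) ->
  (forall x, A x -> c%:E <= f x) -> c%:E * mu A <= \int[mu]_x f x.
Proof.
move=> mA c0 f0 cf; rewrite -integral_cst// integral_mkcond.
apply: ge0_le_integral_nonmeasurable => x.
  by rewrite erestrict_ge0// => y _; rewrite lee_fin.
by rewrite patchE; case: ifPn => [/set_mem/cf|_].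
Qed.

(** For simple functions the identity is the density hypothesis plus linearity; monotone convergence
    along the approximations [g] extends it to [f]. *)
Lemma ge0_integral_density mu (nu : {measure set T -> \bar R}) (w : T -> R)
    (f : T -> \bar R) :
  measurable_fun [set: T] w -> (forall x, (0 <= w x)%R) ->
  (forall A, measurable A -> nu A = \int[mu]_(x in A) (w x)%:E) ->
  measurable_fun [set: T] f -> (forall x, 0 <= f x) ->
  \int[nu]_x f x = \int[mu]_x (f x * (w x)%:E).
Proof.
move=> mw w0 nuE mf f0; pose g := nnsfun_approx measurableT mf.
have mEw : measurable_fun [set: T] (EFin \o w) by exact/measurable_EFinP.
have mEg n : measurable_fun [set: T] (fun x => (g n x)%:E).
  exact/measurable_EFinP.
transitivity (limn (fun n => \int[nu]_x (g n x)%:E)).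
  rewrite -monotone_convergence//.
  - by apply: eq_integral => x _; apply/esym/cvg_lim => //; exact: cvg_nnsfun_approx.
  - by move=> n x _; rewrite lee_fin.
  - by move=> x _ a b ab; rewrite lee_fin; exact/lefP/nd_nnsfun_approx.
transitivity (limn (fun n => \int[mu]_x ((g n x)%:E * (w x)%:E))); last first.
  rewrite -monotone_convergence//.
  - apply: eq_integral => x _; apply/cvg_lim => //.
    under eq_fun do rewrite muleC.
    rewrite muleC; apply: cvgeZl => //; exact: cvg_nnsfun_approx.
  - by move=> n; apply: emeasurable_funM.
  - by move=> n x _; rewrite -EFinM lee_fin mulr_ge0.
  - move=> x _ a b ab; rewrite lee_wpmul2r ?lee_fin//.
    exact/lefP/nd_nnsfun_approx.
congr (limn _); apply/funext => n.
have fin_g := fimfunP (g n).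
transitivity (\sum_(r \in range (g n)) (r%:E * nu (g n @^-1` [set r]))).
  by rewrite integral_nnsfun// patch_setT sintegralE.
under [RHS]eq_integral => x _.
  rewrite fimfunE -fsumEFin// ge0_mule_fsuml; last first.
    by move=> r; rewrite lee_fin; exact: nnfun_muleindic_ge0.
  over.
rewrite /= ge0_integral_fsum//; last 2 first.
- by move=> r; apply: emeasurable_funM => //; apply/measurable_EFinP;
    exact: measurable_funM.
- by move=> r x _; rewrite mule_ge0 ?lee_fin//; exact: nnfun_muleindic_ge0.
apply: eq_fsbigr => r /set_mem [t _ <-].
under [RHS]eq_integral => x _ do rewrite EFinM -muleA.
rewrite ge0_integralZl ?lee_fin//; last 2 first.
- by apply: emeasurable_funM => //; exact/measurable_EFinP.
- by move=> x _; rewrite mule_ge0 ?lee_fin.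
congr (_ * _); rewrite nuE// integral_mkcond; apply: eq_integral => x _.
by rewrite epatch_indic muleC.
Qed.

End integral_complements.

(** * Integrals of products of one-coordinate functions *)

Lemma measurable_rV_compose (R : realType) n (i : 'I_n) (F : R -> R) :
  measurable_fun [set: measurableTypeR R] F ->
  measurable_fun [set: 'rV[R]_n] (fun x : 'rV[R]_n => F (x 0 i)).
Proof.
move=> mF; rewrite (_ : (fun _ => _) = F \o @rV_coord R n i)//.
exact: measurableT_comp (measurable_rV_coord i).
Qed.

(** Induction on the dimension: Lebesgue measure one dimension up is the image of a product measure,
    so Tonelli splits off the first coordinate. *)
Lemma ge0_integral_rV_prod (R : realType) n (F : 'I_n -> R -> R) :
  (forall i, measurable_fun [set: measurableTypeR R] (F i)) ->
  (forall i t, 0 <= F i t) ->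
  (\int[lebesgue_rV R n]_x (\prod_(i < n) F i (x 0 i))%:E =
   \prod_(i < n) \int[lebesgue_measure]_t (F i t)%:E)%E.
Proof.
elim: n F => [|n IHn] F mF F0.
  rewrite big_ord0 (eq_integral (cst 1%E)); last by move=> x _; rewrite big_ord0.
  by rewrite integral_cst// mul1e/= diracE mem_set.
have mprod k (G : 'I_k -> R -> R) :
    (forall i, measurable_fun [set: measurableTypeR R] (G i)) ->
    measurable_fun [set: 'rV[R]_k]
      (fun x : 'rV[R]_k => (\prod_(i < k) G i (x 0 i))%:E).
  move=> mG; apply/measurable_EFinP; apply: measurable_prod => i _.
  exact: measurable_rV_compose.
rewrite big_ord_recl [LHS]/= /cons_measure.
rewrite ge0_integral_pushforward//=; last 3 first.
- exact: measurable_rV_cons.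
- exact: mprod.
- by move=> x _; rewrite lee_fin prodr_ge0.
rewrite preimage_setT.
pose G j := F (lift ord0 j).
rewrite (eq_integral (fun z : measurableTypeR R * 'rV[R]_n =>
    ((F ord0 z.1)%:E * (\prod_(i < n) G i (z.2 0 i))%:E)%E)); last first.
  move=> z _ /=; rewrite big_ord_recl /rV_cons mxE unlift_none EFinM.
  by congr (_ * _%:E)%E; apply: eq_bigr => i _; rewrite mxE liftK.
rewrite fubini_tonelli1//=; last 2 first.
- apply: emeasurable_funM.
    by apply/measurable_EFinP; exact: measurableT_comp (mF ord0) measurable_fst.
  have mG : measurable_fun [set: 'rV[R]_n]
      (fun x : 'rV[R]_n => (\prod_(i < n) G i (x 0 i))%:E).
    by apply: mprod => i; exact: mF.
  exact: measurableT_comp mG measurable_snd.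
- by move=> z; rewrite mule_ge0 ?lee_fin ?prodr_ge0// => i _; exact: F0.
rewrite /fubini_F/=.
under eq_integral => t _.
  rewrite ge0_integralZl//=; last 3 first.
  - by apply: mprod => i; exact: mF.
  - by move=> x _; rewrite lee_fin prodr_ge0// => i _; exact: F0.
  - by rewrite lee_fin.
  rewrite IHn; [|by move=> i; exact: mF|by move=> i s; exact: F0].
  over.
rewrite /= ge0_integralZr//.
- exact/measurable_EFinP.
- by move=> t _; rewrite lee_fin.
- by apply: prode_ge0 => i _; apply: integral_ge0 => t _; rewrite lee_fin F0.
Qed.

(** * Moments of the density [exp(-|t|^p / p)] on the line *)

Section generalized_gaussian_moments.
Context {R : realType}.
Implicit Types (p s a x : R).

Lemma continuous_normr_powR a : 0 <= a -> continuous (fun x : R => `|x| `^ a).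
Proof.
rewrite le_eqVlt => /predU1P[<-|a0] x.
  by under eq_fun do rewrite powRr0; exact: cvg_cst.
have [->|x0] := eqVneq x 0; last first.
  apply: (@continuous_comp _ _ _ (fun x => `|x|) (fun x => x `^ a)).
    exact: norm_continuous.
  apply/differentiable_continuous/derivable1_diffP/derivable_powR.
  by rewrite in_itv/= andbT normr_gt0.
rewrite /continuous_at normr0 powR0 ?gt_eqF//.
apply/cvgr0Pnorm_lt => e e0.
have ltd := @nbhs0_lt R R _ (powR_gt0 a^-1 e0).
near=> y.
rewrite ger0_norm ?powR_ge0//.
have [->|y0] := eqVneq y 0; first by rewrite normr0 powR0 ?gt_eqF.
rewrite -[e in _ < e]powRr1 ?ltW// -(@mulVf _ a) ?gt_eqF// powRrM.
rewrite gt0_ltr_powR ?nnegrE ?powR_ge0//.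
by near: y; exact: ltd.
Unshelve. all: by end_near. Qed.

Definition exp_power p x := expR (- (p^-1 * `|x| `^ p)).

Definition power_weight p s x := `|x| `^ s * exp_power p x.

Lemma power_weight_ge0 p s x : 0 <= power_weight p s x.
Proof. by rewrite mulr_ge0 ?powR_ge0 ?expR_ge0. Qed.

Lemma power_weightN p s x : power_weight p s (- x) = power_weight p s x.
Proof. by rewrite /power_weight /exp_power normrN. Qed.

Lemma power_weight0 p x : power_weight p 0 x = exp_power p x.
Proof. by rewrite /power_weight powRr0 mul1r. Qed.

Lemma continuous_exp_power p : 0 <= p -> continuous (exp_power p).
Proof.
move=> p0 x.
apply: (@continuous_comp _ _ _ (fun x => - (p^-1 * `|x| `^ p)) (@expR R)).
  by apply: cvgN; apply: cvgMr; exact: continuous_normr_powR.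
exact: continuous_expR.
Qed.

Lemma continuous_power_weight p s : 0 <= p -> 0 <= s ->
  continuous (power_weight p s).
Proof.
move=> p0 s0 x; apply: cvgM; first exact: continuous_normr_powR.
exact: continuous_exp_power.
Qed.

Lemma is_derive_normr_powR a x : x != 0 ->
  is_derive x 1 (fun y : R => `|y| `^ a) (a * Num.sg x * `|x| `^ (a - 1)).
Proof.
move=> xneq0; have [x0|x0|x0] := ltgtP x 0; last by rewrite x0 eqxx in xneq0.
- apply: (@near_eq_is_derive _ _ _ (fun y : R => (- y) `^ a)).
    near=> y; rewrite ltr0_norm//; near: y; exact: lt_nbhsl.
  have mx0 : 0 < - x by rewrite oppr_gt0.
  have dN : is_derive x 1 (fun y : R => - y) (- 1) by exact: is_deriveNid.
  have := @is_derive1_comp R (fun y => y `^ a) -%R x _ _ (is_derive1_powR a mx0) dN.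
  move/is_derive_eq; apply.
  by rewrite ltr0_sg// ltr0_norm// mulrAC.
- apply: (@near_eq_is_derive _ _ _ (fun y : R => y `^ a)).
    near=> y; rewrite gtr0_norm//; near: y; exact: lt_nbhsr.
  have := is_derive1_powR a x0.
  by move/is_derive_eq; apply; rewrite gtr0_sg// gtr0_norm// mulr1.
Unshelve. all: by end_near. Qed.

(** Integrated over the positive half-line, this derivative becomes the recursion
    [(s + 1) M(s) = M(s + p)]. *)
Lemma is_derive_power_weight p s x : 0 < p -> 0 < x ->
  is_derive x 1 (power_weight p (s + 1))
    ((s + 1) * power_weight p s x - power_weight p (s + p) x).
Proof.
move=> p0 x0; have xneq0 : x != 0 by rewrite gt_eqF.
have d1 := @is_derive_normr_powR (s + 1) x xneq0.
have d2 : is_derive x 1 (fun y : R => - (p^-1 * `|y| `^ p))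
    (- (p^-1 * (p * Num.sg x * `|x| `^ (p - 1)))).
  by apply: is_deriveN; apply: is_deriveZ; exact: is_derive_normr_powR.
have d3 := @is_derive1_comp R (@expR R) _ x _ _ (is_derive_expR _) d2.
have := is_deriveM d1 d3; move/is_derive_eq; apply.
rewrite /power_weight /exp_power gtr0_sg// !gtr0_norm// !mulr1 addrK.
rewrite mulKf ?gt_eqF// mulrN scalerN /GRing.scale/= addrC.
rewrite (_ : s + p = s + 1 + (p - 1)); last by ring.
rewrite (@powRD _ _ (s + 1)) ?xneq0 ?implybT//.
rewrite [expR (- (p^-1 * `|x| `^ p))](_ : _ = expR (- (p^-1 * x `^ p))).
  by ring.
by rewrite gtr0_norm.
Qed.

Lemma power_weight_cvg0 p s : 1 < p -> 0 <= s <= 2 ->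
  power_weight p s n%:R @[n --> \oo] --> 0.
Proof.
move=> p1 /andP[s0 s2]; have p0 : 0 < p by lra.
(* [expR t >= t^2/2] bounds the weight by [2 p^2 n^(2 - 2p)]. *)
have bound (n : nat) : (0 < n)%N ->
    power_weight p s n%:R <= 2 * p ^+ 2 * (n%:R `^ (2 * p - 2))^-1.
  move=> n0; have n1 : 1 <= n%:R :> R by rewrite ler1n.
  have nR0 : 0 < n%:R :> R by rewrite ltr0n.
  rewrite /power_weight /exp_power ger0_norm// expRN.
  set t := p^-1 * n%:R `^ p.
  have t0 : 0 < t by rewrite mulr_gt0 ?invr_gt0 ?powR_gt0.
  have et : t ^+ 2 / 2 <= expR t.
    by rewrite (le_trans _ (expR_ge1Dxn 1 (ltW t0)))// lerDr.
  have t2 : 0 < t ^+ 2 / 2 by rewrite divr_gt0// exprn_gt0.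
  rewrite (@le_trans _ _ (n%:R `^ 2 * (t ^+ 2 / 2)^-1))//.
    rewrite ler_pM ?powR_ge0 ?invr_ge0 ?expR_ge0 ?ler_powR//.
    by rewrite lef_pV2 ?posrE// expR_gt0.
  rewrite powRB; last by rewrite (gt_eqF nR0) implybT.
  rewrite (mulrC 2 p) powRrM /t !powR_mulrn ?powR_ge0//.
  rewrite le_eqVlt; apply/orP; left; apply/eqP; field.
  by rewrite ?gt_eqF ?powR_gt0.
apply/cvgr0Pnorm_le => e e0.
have e'0 : 0 < 2 * p ^+ 2 / e by rewrite divr_gt0// mulr_gt0// exprn_gt0.
near=> n.
rewrite ger0_norm ?power_weight_ge0//.
have n0 : (0 < n)%N by near: n; exact: nbhs_infty_gt.
have nR0 : 0 < n%:R :> R by rewrite ltr0n.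
have nbig : 2 * p ^+ 2 / e <= n%:R `^ (2 * p - 2).
  have e1 : (2 * p - 2)^-1 * (2 * p - 2) = 1 by rewrite mulVf//; lra.
  rewrite [leLHS](_ : _ = (2 * p ^+ 2 / e) `^ (2 * p - 2)^-1 `^ (2 * p - 2));
    last by rewrite -powRrM e1 powRr1 ?ltW.
  apply: ge0_ler_powR; rewrite ?nnegrE ?powR_ge0//; first lra.
  by near: n; exact: nbhs_infty_ger.
rewrite (le_trans (bound n n0))// ler_pdivrMr ?powR_gt0//.
by rewrite -ler_pdivrMl// [leLHS]mulrC.
Unshelve. all: by end_near. Qed.

(** Extended real values allow the recursion to be proved before any moment is known to be
    finite. *)
Definition half_moment p s : \bar R :=
  (\int[lebesgue_measure]_(x in `[0%R, +oo[) (power_weight p s x)%:E)%E.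

Lemma measurable_power_weight p s : 0 <= p -> 0 <= s ->
  measurable_fun [set: measurableTypeR R] (power_weight p s).
Proof.
by move=> p0 s0; apply: continuous_measurable_fun; exact: continuous_power_weight.
Qed.

(** On a compact segment the continuous weights are integrable, so the fundamental theorem of
    calculus applies and the two terms of the derivative can be separated. *)
Lemma segment_moment_by_parts p s (n : nat) : 0 < p -> 0 <= s -> (0 < n)%N ->
  ((s + 1)%:E * \int[lebesgue_measure]_(x in `[0%R, n%:R]) (power_weight p s x)%:E =
   (power_weight p (s + 1) n%:R)%:E +
   \int[lebesgue_measure]_(x in `[0%R, n%:R]) (power_weight p (s + p) x)%:E)%E.
Proof.
move=> p0 s0 n0.
have nR0 : 0 < n%:R :> R by rewrite ltr0n.
have cw a : 0 <= a -> continuous (power_weight p a).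
  by move=> a0; apply: continuous_power_weight => //; exact: ltW.
have cs : 0 <= s + 1 by lra.
have csp : 0 <= s + p by lra.
have iw a : 0 <= a ->
    lebesgue_measure.-integrable `[0%R, n%:R] (EFin \o power_weight p a).
  move=> a0; apply: continuous_compact_integrable; first exact: segment_compact.
  by apply: continuous_subspaceT; exact: cw.
pose f := (fun x : R => (s + 1) * power_weight p s x - power_weight p (s + p) x).
have cf : continuous f.
  by move=> x; apply: cvgB; [apply: cvgMr; exact: cw|exact: cw].
have := @continuous_FTC2 R f (power_weight p (s + 1)) 0 n%:R nR0.
move=> /(_ (continuous_subspaceT cf)) FTC.
(* The boundary term at 0 vanishes because the exponent [s + 1] is positive. *)
have w0 : power_weight p (s + 1) 0 = 0.
  by rewrite /power_weight normr0 powR0 ?mul0r// gt_eqF//; lra.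
move: FTC; rewrite w0 sube0 => <-.
- under [X in _ = (X + _)%E]eq_integral do rewrite /f EFinB EFinM.
  rewrite integralB//=; last 2 first.
  + by apply: integrableZl => //; exact: iw.
  + exact: iw.
  rewrite integralZl//; last exact: iw.
  by rewrite subeK// integrable_fin_num//; exact: iw.
- split.
  + move=> x; rewrite in_itv/= => /andP[x0 _].
    by have [] := is_derive_power_weight s p0 x0.
  + exact/cvg_at_right_filter/cw.
  + exact/cvg_at_left_filter/cw.
- move=> x; rewrite in_itv/= => /andP[x0 _].
  by rewrite derive1E; have [_ ->] := is_derive_power_weight s p0 x0.
Qed.

(** Limit of the identity on [[0, n]]: the integrals converge monotonically, and the boundary term
    tends to 0 since its exponent [s + 1] is at most 2. *)
Lemma half_moment_by_parts p s : 1 < p -> 0 <= s <= 1 ->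
  ((s + 1)%:E * half_moment p s = half_moment p (s + p))%E.
Proof.
move=> p1 /andP[s0 s1].
have cvgm a : 0 <= a ->
    (\int[lebesgue_measure]_(x in `[0%R, n%:R]) (power_weight p a x)%:E
      @[n --> \oo] --> half_moment p a)%E.
  move=> a0; apply: ge0_cvgn_integral; first by move=> x; exact: power_weight_ge0.
  by apply: measurable_power_weight => //; lra.
have p0 : 0 < p by lra.
have sp0 : 0 <= s + p by lra.
have l1 : ((s + 1)%:E * \int[lebesgue_measure]_(x in `[0%R, n%:R]) (power_weight p s x)%:E
    @[n --> \oo] --> (s + 1)%:E * half_moment p s)%E.
  by apply: cvgeZl => //; exact: cvgm.
have l2 : ((power_weight p (s + 1) n%:R)%:E +
   \int[lebesgue_measure]_(x in `[0%R, n%:R]) (power_weight p (s + p) x)%:E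
    @[n --> \oo] --> 0 + half_moment p (s + p))%E.
  apply: cvgeD; [by []| |exact: cvgm].
  by apply: cvg_EFin; [exact: nearW|apply: power_weight_cvg0 => //; lra].
rewrite add0e in l2.
apply: (cvg_unique _ _ l2) => //; apply: cvg_trans l1.
apply: near_eq_cvg; near=> n; rewrite segment_moment_by_parts//.
by near: n; exact: nbhs_infty_gt.
Unshelve. all: by end_near. Qed.

Definition moment p s : \bar R :=
  (\int[lebesgue_measure]_x (power_weight p s x)%:E)%E.

Lemma moment_half p s : 0 <= p -> 0 <= s ->
  moment p s = (2%:E * half_moment p s)%E.
Proof.
move=> p0 s0; rewrite /moment /half_moment ge0_symfun_integralT.
- by rewrite set_itvcy.
- by move=> x; exact: power_weight_ge0.
- exact: continuous_power_weight.
- by move=> x /=; rewrite power_weightN.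
Qed.

Lemma moment_by_parts p s : 1 < p -> 0 <= s <= 1 ->
  ((s + 1)%:E * moment p s = moment p (s + p))%E.
Proof.
move=> p1 s01; have p0 : 0 <= p by lra.
rewrite !moment_half//; [|lra|lra].
by rewrite muleCA half_moment_by_parts.
Qed.

Lemma moment_ge0 p s : (0 <= moment p s)%E.
Proof. by apply: integral_ge0 => x _; rewrite lee_fin power_weight_ge0. Qed.

(** Pointwise, [|x|^q] is at most [|x|^r] if [|x| >= 1] and at most [|x|^s] otherwise. Hence a
    moment lying between two finite ones is finite. *)
Lemma moment_le p s q r : 0 <= p -> 0 <= s -> s <= q -> q <= r ->
  (moment p q <= moment p s + moment p r)%E.
Proof.
move=> p0 s0 sq qr; have q0 : 0 <= q by lra.
have r0 : 0 <= r by lra.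
have mw a : 0 <= a ->
    measurable_fun [set: measurableTypeR R] (fun x => (power_weight p a x)%:E).
  by move=> a0; apply/measurable_EFinP; exact: measurable_power_weight.
rewrite /moment -ge0_integralD//; last 4 first.
- by move=> x _; rewrite lee_fin power_weight_ge0.
- exact: mw.
- by move=> x _; rewrite lee_fin power_weight_ge0.
- exact: mw.
apply: ge0_le_integral_nonmeasurable => x; first by rewrite lee_fin power_weight_ge0.
rewrite -EFinD lee_fin /power_weight -mulrDl ler_pM2r ?expR_gt0//.
have [x1|x1] := leP 1 `|x|.
  by rewrite (le_trans (ler_powR x1 qr))// lerDr powR_ge0.
have [->|x0] := eqVneq x 0.
  rewrite normr0; have [->|s'0] := eqVneq s 0.
    rewrite powRr0; have [->|q'0] := eqVneq q 0.
      by rewrite powRr0 lerDl powR_ge0.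
    by rewrite powR0// addr_ge0// powR_ge0.
  by rewrite powR0 ?addr_ge0 ?powR_ge0//; lra.
rewrite (@le_trans _ _ (`|x| `^ s))// ?lerDl ?powR_ge0//.
by apply: ger_powR => //; rewrite normr_gt0 x0 ltW.
Qed.

End generalized_gaussian_moments.

(** * Gradient and Hessian of the potential, and gradient of the test function *)

Section partial_derivatives.
Context {R : realType} {n : nat}.
Implicit Types (f : 'rV[R]_n -> R) (x v : 'rV[R]_n) (i j : 'I_n) (p t : R).

Lemma derive_along_line f x v :
  'D_v f x = 'D_1 (fun h : R => f (h *: v + x)) 0.
Proof.
rewrite /derive (_ : (fun h => h^-1 *: ((f \o shift x) (h *: v) - f x)) =
  (fun h : R => h^-1 *: (((fun k : R => f (k *: v + x)) \o shift 0) (h *: 1) -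
    f (0 *: v + x))))//.
by apply/funext => h /=; rewrite scale0r add0r addr0 [h *: 1]mulr1.
Qed.

(** A partial derivative sees only the restriction of [f] to a line parallel to an axis; [c]
    collects the contribution of the other coordinates. Equality near 0 is asked for because the
    formulas for the potential hold only off the coordinate hyperplanes. *)
Lemma derive_coord f (g : R -> R) (c : R) x i d :
  (\forall h \near nbhs (0 : R), f (h *: delta_mx 0 i + x) = c + g (h + x 0 i)) ->
  is_derive (x 0 i) 1 g d -> 'D_(delta_mx 0 i) f x = d.
Proof.
move=> fg dg; rewrite derive_along_line (near_eq_derive _ fg).
have dg0 : is_derive (0 + x 0 i) 1 g d by rewrite add0r.
have dh : is_derive (0 : R) 1 (fun h : R => h + x 0 i) 1.
  by apply: is_derive_eq; rewrite addr0.
have dc := @is_derive1_comp R g (fun h => h + x 0 i) 0 _ _ dg0 dh.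
have dcst := is_derive_cst c (0 : R) 1.
have [_ ->] := is_deriveD dcst dc.
by rewrite add0r mulr1.
Qed.

Lemma coord_line x i h j :
  (h *: delta_mx 0 i + x) 0 j = (if j == i then h else 0) + x 0 j.
Proof. by rewrite !mxE eqxx/=; case: eqP => _; rewrite ?mulr1 ?mulr0. Qed.

Lemma lp_potentialE p x : 0 < p ->
  lp_potential p x = p^-1 * \sum_(i < n) `|x 0 i| `^ p.
Proof.
move=> p0; rewrite /lp_potential /lpnorm -powRrM mulVf ?gt_eqF// powRr1//.
by apply: sumr_ge0 => i _; exact: powR_ge0.
Qed.

(** For [a = p - 1] this is the derivative of [|t|^p / p] at [t != 0]. *)
Definition signed_powR (a t : R) := Num.sg t * `|t| `^ a.

Lemma derive_lp_potential p x i : 0 < p -> x 0 i != 0 ->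
  'D_(delta_mx 0 i) (lp_potential p) x = signed_powR (p - 1) (x 0 i).
Proof.
move=> p0 xi0.
apply: (@derive_coord _ (fun t => p^-1 * `|t| `^ p)
  (p^-1 * \sum_(j < n | j != i) `|x 0 j| `^ p)).
  apply: nearW => h; rewrite lp_potentialE// -mulrDr; congr (_ * _).
  rewrite (bigD1 i)//= addrC coord_line eqxx; congr (_ + _).
  by apply: eq_bigr => j ji; rewrite coord_line (negbTE ji) add0r.
have d1 : is_derive (x 0 i) 1 (fun t : R => p^-1 * `|t| `^ p)
    (p^-1 * (p * Num.sg (x 0 i) * `|x 0 i| `^ (p - 1))).
  by apply: is_deriveZ; exact: is_derive_normr_powR.
by move/is_derive_eq : d1; apply; rewrite !mulrA mulVf ?gt_eqF// mul1r.
Qed.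

Lemma is_derive_signed_powR a t : t != 0 ->
  is_derive t 1 (signed_powR a) (a * `|t| `^ (a - 1)).
Proof.
move=> t0.
apply: (@near_eq_is_derive _ _ _ (fun s : R => Num.sg t * `|s| `^ a)).
  have [tp|tn|tE] := ltgtP t 0; last by rewrite tE eqxx in t0.
  - by near=> s; rewrite /signed_powR !ltr0_sg//; near: s; exact: lt_nbhsl.
  - by near=> s; rewrite /signed_powR !gtr0_sg//; near: s; exact: lt_nbhsr.
have d1 : is_derive t 1 (fun s : R => Num.sg t * `|s| `^ a)
    (Num.sg t * (a * Num.sg t * `|t| `^ (a - 1))).
  by apply: is_deriveZ; exact: is_derive_normr_powR.
move/is_derive_eq : d1; apply.
by rewrite mulrA mulrCA -expr2 sqr_sg t0 mulr1.
Unshelve. all: by end_near. Qed.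

Lemma hessian_lp_potential p x : 0 < p -> (forall i, x 0 i != 0) ->
  hessian (lp_potential p) x =
  diag_mx (\row_i ((p - 1) * `|x 0 i| `^ (p - 2))).
Proof.
move=> p0 x0; apply/matrixP => i j; rewrite !mxE.
have [<-|ij] := eqVneq i j.
  rewrite mulr1n (_ : p - 2 = p - 1 - 1); last by ring.
  apply: (@derive_coord _ (signed_powR (p - 1)) 0); last first.
    exact: is_derive_signed_powR.
  (* So small an [h] keeps the ith coordinate nonzero, where the formula for the first derivative is
     valid. *)
  have xh : \forall h \near (0 : R), `|h| < `|x 0 i|.
    by apply: (@nbhs0_lt R R); rewrite normr_gt0.
  near=> h; rewrite derive_lp_potential// coord_line eqxx ?add0r//.
  rewrite addr_eq0; apply/eqP => hx.
  have : `|h| < `|x 0 i| by near: h.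
  by rewrite hx normrN ltxx.
rewrite mulr0n.
(* The jth partial derivative depends on the jth coordinate alone, so it is constant along the ith
   axis. *)
apply: (@derive_coord _ (cst 0) (signed_powR (p - 1) (x 0 j))).
  have ji : (j == i) = false by rewrite eq_sym (negbTE ij).
  apply: nearW => h; rewrite addr0 derive_lp_potential//.
    by rewrite coord_line ji add0r.
  by rewrite coord_line ji add0r.
Unshelve. all: by end_near. Qed.

Lemma invmx_diag (d : 'rV[R]_n) : (forall i, d 0 i != 0) ->
  invmx (diag_mx d) = diag_mx (\row_i (d 0 i)^-1).
Proof.
move=> d0.
have dd : diag_mx d *m diag_mx (\row_i (d 0 i)^-1) = 1%:M.
  apply/matrixP => i j; rewrite mul_diag_mx !mxE.
  by case: (i == j); rewrite ?mulr0// mulr1n mulfV.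
have [ud _] := mulmx1_unit dd.
by rewrite -[RHS](mulKmx ud) dd mulmx1.
Qed.

(** The Hessian is diagonal with entries [(p - 1) |x_i|^(p - 2)], so inverting it produces the
    weights [|x_i|^(2 - p) / (p - 1)]. *)
Lemma BL_integrand p x v : p != 1 -> 0 < p -> (forall i, x 0 i != 0) ->
  dotr (v *m invmx (hessian (lp_potential p) x)) v =
  (p - 1)^-1 * \sum_(i < n) `|x 0 i| `^ (2 - p) * v 0 i ^+ 2.
Proof.
move=> p1 p0 x0; rewrite hessian_lp_potential// invmx_diag; last first.
  move=> i; rewrite mxE mulf_neq0 ?subr_eq0//.
  by rewrite powR_eq0 normr_eq0 (negbTE (x0 i)).
rewrite /dotr mulr_sumr; apply: eq_bigr => i _.
rewrite mul_mx_diag !mxE invfM -powRN opprB expr2.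
by ring.
Qed.

Lemma grad_lp_potential p x : 0 < p -> (forall i, x 0 i != 0) ->
  grad (lp_potential p) x = \row_i signed_powR (p - 1) (x 0 i).
Proof. by move=> p0 x0; apply/rowP => i; rewrite !mxE derive_lp_potential. Qed.

Lemma grad_coord_prod (i j : 'I_n) x : i != j ->
  grad (fun y : 'rV[R]_n => y 0 i * y 0 j) x =
  x 0 j *: delta_mx 0 i + x 0 i *: delta_mx 0 j.
Proof.
move=> ij; apply/rowP => k; rewrite !mxE eqxx/=.
have lin (c t : R) : is_derive t 1 (fun s : R => c * s) c.
  by apply: is_derive_eq; rewrite /GRing.scale/= mulr1.
have [->|ki] := eqVneq k i.
  rewrite (negbTE ij) mulr1 mulr0 addr0.
  apply: (@derive_coord _ (fun s => x 0 j * s) 0) => //.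
  apply: nearW => h; rewrite !coord_line eqxx eq_sym (negbTE ij).
  by ring.
have [->|kj] := eqVneq k j.
  rewrite mulr1 mulr0 add0r.
  apply: (@derive_coord _ (fun s => x 0 i * s) 0) => //.
  apply: nearW => h; rewrite !coord_line eqxx (negbTE ij).
  by ring.
rewrite !mulr0 addr0; apply: (@derive_coord _ (cst 0) (x 0 i * x 0 j)).
  apply: nearW => h.
  by rewrite !coord_line eq_sym (negbTE ki) eq_sym (negbTE kj) !add0r addr0.
Qed.

Lemma C1_coord_prod (i j : 'I_n) : i != j ->
  C1_fun (fun y : 'rV[R]_n => y 0 i * y 0 j).
Proof.
move=> ij; split=> x.
  by apply: differentiableM; exact: differentiable_coord.
rewrite (_ : grad _ = (fun y : 'rV[R]_n =>
  y 0 j *: (delta_mx 0 i : 'rV[R]_n) + y 0 i *: (delta_mx 0 j : 'rV[R]_n))).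
  have cZ k l : {for x, continuous
      (fun y : 'rV[R]_n => y 0 k *: (delta_mx 0 l : 'rV[R]_n))}.
    by apply: continuousZ; [exact: coord_continuous|exact: cst_continuous].
  exact: continuousD (cZ j i) (cZ i j).
by apply/funext => y; rewrite grad_coord_prod.
Qed.

End partial_derivatives.

(** * The probability measure as a product of one-dimensional densities *)

Section exp_lp_potential.
Context {R : realType} {n : nat}.
Implicit Type x : 'rV[R]_n.

Lemma expR_lp_potential (p : R) x : 0 < p ->
  expR (- lp_potential p x) = \prod_(i < n) exp_power p (x 0 i).
Proof. by move=> p0; rewrite lp_potentialE// mulr_sumr -sumrN expR_sum. Qed.

Lemma measurable_exp_power (p : R) : 0 <= p ->
  measurable_fun [set: measurableTypeR R] (exp_power p).
Proof.
by move=> p0; apply: continuous_measurable_fun; exact: continuous_exp_power.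
Qed.

Lemma measurable_rV_prod (G : 'I_n -> R -> R) :
  (forall i, measurable_fun [set: measurableTypeR R] (G i)) ->
  measurable_fun [set: 'rV[R]_n] (fun x => \prod_(i < n) G i (x 0 i)).
Proof.
move=> mG; apply: measurable_prod => i _.
exact: (measurable_rV_compose i (mG i)).
Qed.

Lemma measurable_expR_lp_potential (p : R) : 0 < p ->
  measurable_fun [set: 'rV[R]_n] (fun x => expR (- lp_potential p x)).
Proof.
move=> p0; under eq_fun do rewrite expR_lp_potential//.
apply: (@measurable_rV_prod (fun=> exp_power p)) => i.
by apply: measurable_exp_power; exact: ltW.
Qed.

End exp_lp_potential.

Section lp_measure.
Context {R : realType} {m : nat}.
Local Notation n := m.+2.
Variables (p : R) (hp : 1 < p < 2) (C : R) (hC : 0 < C).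
Variables (mu : probability 'rV[R]_n R).
Hypothesis hmu : forall A : set 'rV[R]_n, measurable A ->
  mu A = (\int[lebesgue_rV R n]_(x in A) (C * expR (- lp_potential p x))%:E)%E.

Local Notation i0 := (ord0 : 'I_n).
Local Notation i1 := (lift ord0 ord0 : 'I_n).

Let p0 : 0 < p. Proof. by case/andP: hp => ? _; lra. Qed.

Let exp_power_gt0 (t : R) : 0 < exp_power p t.
Proof. exact: expR_gt0. Qed.

Let integral_lp_prod (F : 'I_n -> R -> R) :
  (forall i, measurable_fun [set: measurableTypeR R] (F i)) ->
  (forall i t, 0 <= F i t) ->
  (\int[mu]_x (\prod_(i < n) F i (x 0 i))%:E =
   C%:E * \prod_(i < n) \int[lebesgue_measure]_t (F i t * exp_power p t)%:E)%E.
Proof.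
move=> mF F0.
have mFe i : measurable_fun [set: measurableTypeR R]
    (fun t => F i t * exp_power p t).
  by apply: measurable_funM => //; apply: measurable_exp_power; exact: ltW.
rewrite (ge0_integral_density _ _ hmu)//; last 4 first.
- by apply: measurable_funM => //; exact: measurable_expR_lp_potential.
- by move=> x; rewrite mulr_ge0 ?expR_ge0 ?ltW.
- by apply/measurable_EFinP; exact: measurable_rV_prod.
- by move=> x; rewrite lee_fin prodr_ge0.
under eq_integral => x _.
  rewrite -EFinM mulrCA expR_lp_potential// -big_split/= EFinM.
  over.
rewrite ge0_integralZl//; last 3 first.
- by apply/measurable_EFinP; exact: (measurable_rV_prod (G := fun i t => F i t * exp_power p t)).
- by move=> x _; rewrite lee_fin; apply: prodr_ge0 => i _; rewrite mulr_ge0// ltW.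
- by rewrite lee_fin ltW.
rewrite (@ge0_integral_rV_prod _ _ (fun i t => F i t * exp_power p t))//.
by move=> i t; rewrite mulr_ge0// ltW.
Qed.

Let two_coords (F0 F1 : R -> R) (i : 'I_n) : R -> R :=
  if i == i0 then F0 else if i == i1 then F1 else cst 1.

Let prod_two_coords (F0 F1 : R -> R) (x : 'rV[R]_n) :
  F0 (x 0 i0) * F1 (x 0 i1) = \prod_(i < n) two_coords F0 F1 i (x 0 i).
Proof.
by rewrite !big_ord_recl /two_coords/= big1 ?mulr1.
Qed.

Let m0 := moment p 0.

Let exp_power_moment : (\int[lebesgue_measure]_t (1 * exp_power p t)%:E)%E = m0.
Proof. by apply: eq_integral => t _; rewrite power_weight0 mul1r. Qed.

Let rest : \bar R := (\prod_(i < m) m0)%E.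

Let integral_two_coords (F0 F1 : R -> R) :
  measurable_fun [set: measurableTypeR R] F0 ->
  measurable_fun [set: measurableTypeR R] F1 ->
  (forall t, 0 <= F0 t) -> (forall t, 0 <= F1 t) ->
  (\int[mu]_x (F0 (x 0 i0) * F1 (x 0 i1))%:E =
   C%:E * (\int[lebesgue_measure]_t (F0 t * exp_power p t)%:E *
   (\int[lebesgue_measure]_t (F1 t * exp_power p t)%:E * rest)))%E.
Proof.
move=> mF0 mF1 F00 F10.
under eq_integral do rewrite prod_two_coords.
rewrite integral_lp_prod; last 2 first.
- by move=> i; rewrite /two_coords; case: ifP => // _; case: ifP.
- by move=> i t; rewrite /two_coords; case: ifP => // _; case: ifP.
rewrite !big_ord_recl /two_coords/=; congr (_ * (_ * (_ * _)))%E.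
by apply: eq_bigr => i _; rewrite exp_power_moment.
Qed.

(** The total mass of a probability, computed as a product; it forces [m0] to be finite and [rest]
    to be nonzero. *)
Let total_mass : (C%:E * (m0 * (m0 * rest)) = 1)%E.
Proof.
rewrite -(@probability_setT _ _ _ mu) -[RHS]mul1e -integral_cst//.
rewrite -[in LHS]exp_power_moment -(integral_two_coords (F0 := cst 1) (F1 := cst 1))//.
by apply: eq_integral => x _; rewrite mul1r.
Qed.

Let m0_ge0 : (0 <= m0)%E. Proof. exact: moment_ge0. Qed.

Let rest_ge0 : (0 <= rest)%E. Proof. by apply: prode_ge0. Qed.

(** If [m0] were +oo, the total mass would be 0 or +oo, according to whether [rest] vanishes, and
    never 1. *)
Lemma lp_measure_moment0_fin : m0 \is a fin_num.
Proof.
rewrite ge0_fin_numE// ltey; apply/eqP => moo.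
have := total_mass; have := rest_ge0; rewrite moo.
case: rest => [r|_|//]; rewrite ?lee_fin.
  rewrite le_eqVlt => /predU1P[<-|r0]; first by rewrite mule0 mule0 mule0 => -[/esym/eqP]; rewrite oner_eq0.
  by rewrite (@gt0_mulye _ r%:E) ?lte_fin// mulyy gt0_muley ?lte_fin.
by rewrite !mulyy gt0_muley ?lte_fin.
Qed.

(** Each remaining coordinate integrates to [m0], so [q] is [C] times [m0] to the power [m]. This
    common factor cancels between variance and energy. *)
Lemma lp_measure_two_coords : exists2 q : R, 0 < q &
  forall F0 F1 : R -> R,
  measurable_fun [set: measurableTypeR R] F0 ->
  measurable_fun [set: measurableTypeR R] F1 ->
  (forall t, 0 <= F0 t) -> (forall t, 0 <= F1 t) ->
  (\int[mu]_x (F0 (x 0 i0) * F1 (x 0 i1))%:E =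
   q%:E * (\int[lebesgue_measure]_t (F0 t * exp_power p t)%:E *
    \int[lebesgue_measure]_t (F1 t * exp_power p t)%:E))%E.
Proof.
have restfin : rest \is a fin_num.
  by rewrite /rest; apply: prode_fin_num => i _; exact: lp_measure_moment0_fin.
exists (C * fine rest).
  rewrite mulr_gt0// fine_gt0// -ge0_fin_numE// restfin andbT lt0e rest_ge0 andbT.
  apply/eqP => r0; have := total_mass; rewrite r0 !mule0 => -[/esym/eqP].
  by rewrite oner_eq0.
move=> F0 F1 mF0 mF1 F00 F10; rewrite integral_two_coords// EFinM fineK//.
by rewrite -muleA; congr (_ * _)%E; rewrite muleA muleC.
Qed.

(** A coordinate hyperplane is a box with one side reduced to a point, hence Lebesgue-null, and [mu]
    has a density. *)
Lemma lp_measure_hyperplanes0 :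
  mu [set x : 'rV[R]_n | exists i, x 0 i = 0] = 0%E /\
  measurable [set x : 'rV[R]_n | exists i, x 0 i = 0].
Proof.
have mH i : measurable [set x : 'rV[R]_n | x 0 i = 0].
  rewrite (_ : mkset _ = @rV_coord R n i @^-1` [set 0])//.
  by rewrite -[X in measurable X]setTI; exact: measurable_rV_coord.
have H0 i : mu [set x : 'rV[R]_n | x 0 i = 0] = 0%E.
  have lH0 : lebesgue_rV R n [set x : 'rV[R]_n | x 0 i = 0] = 0%E.
    pose A j : set (measurableTypeR R) := if j == i then [set 0] else setT.
    rewrite (_ : mkset _ = [set x : 'rV[R]_n | forall j, A j (x 0 j)]).
      rewrite lebesgue_rV_box; last by move=> j; rewrite /A; case: ifP.
      by rewrite (bigD1 i)//= /A eqxx lebesgue_measure_set1 mul0e.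
    apply/seteqP; split => x /=.
      by move=> xi0 j; rewrite /A; case: eqP => [->|].
    by move=> /(_ i); rewrite /A eqxx.
  rewrite hmu//; apply/eqP; rewrite eq_le; apply/andP; split; last first.
    by apply: integral_ge0 => x _; rewrite lee_fin mulr_ge0 ?expR_ge0// ltW.
  rewrite integral_mkcond.
  rewrite -[leRHS](integral0 (lebesgue_rV R n) setT).
  apply: (@ge0_le_integral_off_null _ _ _ (lebesgue_rV R n) _ _ _ (mH i) lH0) => //.
    by move=> x; apply: erestrict_ge0 => y _; rewrite lee_fin mulr_ge0 ?expR_ge0// ltW.
  by move=> x xi0; rewrite patchE memNset.
have mN : measurable [set x : 'rV[R]_n | exists i, x 0 i = 0].
  rewrite (_ : mkset _ = \bigcup_(i in [set: 'I_n]) [set x : 'rV[R]_n | x 0 i = 0]).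
    by apply: fin_bigcup_measurable => // i _; exact: mH.
  by apply/seteqP; split => x /= [i]; [exists i|move=> _; exists i].
split => //; apply/negligibleP => //.
(* The finite union is written as a sequence, empty from index [n] on, to use countable
   subadditivity. *)
pose F k := [set x : 'rV[R]_n | exists2 i : 'I_n, i = k :> nat & x 0 i = 0].
apply: (@negligibleS _ _ _ mu (\bigcup_k F k)).
  by move=> x [i xi0]; exists i => //; exists i.
apply: negligible_bigcup => k; have [kn|nk] := ltnP k n.
  apply: (@negligibleS _ _ _ mu [set x : 'rV[R]_n | x 0 (Ordinal kn) = 0]).
    by move=> x [i ik xi0] /=; rewrite (_ : Ordinal kn = i)//; exact: val_inj.
  by apply/(negligibleP mu (mH _)); exact: H0.
rewrite (_ : F k = set0); first exact: negligible_set0.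
by rewrite -subset0 => x [i ik]; move: (ltn_ord i); rewrite ik ltnNge nk.
Qed.

End lp_measure.

(** * The test function and the best even Brascamp-Lieb constant *)

Lemma ge0_integral_reflect (R : realType) (F : R -> R) :
  measurable_fun [set: measurableTypeR R] F -> (forall t, 0 <= F t) ->
  (\int[lebesgue_measure]_t (F (- t))%:E = \int[lebesgue_measure]_t (F t)%:E)%E.
Proof.
move=> mF F0.
have mN : measurable_fun [set: measurableTypeR R] (-%R : R -> measurableTypeR R).
  exact: (@oppr_measurable R setT).
rewrite -(@ge0_integral_pushforward _ _ _ _ R _ mN lebesgue_measure setT
    (fun t => (F t)%:E))//; last 2 first.
- exact/measurable_EFinP.
- by move=> t _; rewrite lee_fin.
by apply: eq_measure_integral => A mA _; exact: lebesgue_measureN.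
Qed.

(** On [[1, 2]] the weight is at least [exp(-2^p / p)]. *)
Lemma moment_gt0 (R : realType) (p s : R) : 0 <= p -> 0 <= s ->
  (0 < moment p s)%E.
Proof.
move=> p0 s0.
apply: (@lt_le_trans _ _ ((expR (- (p^-1 * 2 `^ p)))%:E *
    lebesgue_measure (`[1%R, 2%R]%classic : set R))%E).
  rewrite lebesgue_measure_itv/= lte_fin ltr1n -EFinB -EFinM lte_fin.
  by rewrite mulr_gt0 ?expR_gt0//; lra.
apply: ge0_measure_le_integral.
- exact: measurable_itv.
- exact: expR_ge0.
- by move=> t; rewrite lee_fin power_weight_ge0.
- move=> t /=; rewrite in_itv/= => /andP[t1 t2]; rewrite lee_fin.
  have nt : `|t| = t by rewrite ger0_norm//; lra.
  rewrite -[leLHS]mul1r ler_pM ?expR_ge0//.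
    by rewrite nt -(powRr0 t) ler_powR.
  rewrite /exp_power nt ler_expR lerN2 ler_wpM2l ?invr_ge0//.
  by apply: ge0_ler_powR => //; rewrite nnegrE; lra.
Qed.

(** It writes the positive part of [x_1 x_2] as a sum of products of nonnegative one-coordinate
    functions, to which the product formula applies. *)
Lemma maxr_mul0 (R : realType) (a b : R) : Num.max (a * b) 0 =
  Num.max a 0 * Num.max b 0 + Num.max (- a) 0 * Num.max (- b) 0.
Proof.
have [a0|a0] := leP 0 a.
  by rewrite (@max_r _ _ (- a) 0) ?oppr_le0// mul0r addr0 maxr_pMr// mulr0.
have Na0 : 0 <= - a by rewrite oppr_ge0 ltW.
by rewrite (@max_l _ _ (- a) 0)// mul0r add0r maxr_pMr// mulr0 mulrNN.
Qed.

Section lp_measure_inequality.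
Context {R : realType} {m : nat}.
Local Notation n := m.+2.
Variables (p : R) (hp : 1 < p < 2) (C : R) (hC : 0 < C).
Variables (mu : probability 'rV[R]_n R).
Hypothesis hmu : forall A : set 'rV[R]_n, measurable A ->
  mu A = (\int[lebesgue_rV R n]_(x in A) (C * expR (- lp_potential p x))%:E)%E.

Local Notation i0 := (ord0 : 'I_n).
Local Notation i1 := (lift ord0 ord0 : 'I_n).

Let f (x : 'rV[R]_n) : R := x 0 i0 * x 0 i1.

Let p1 : 1 < p. Proof. by case/andP: hp. Qed.
Let p2 : p < 2. Proof. by case/andP: hp. Qed.
Let p0 : 0 <= p. Proof. by move: p1; lra. Qed.

Let moment0_fin : moment p 0 \is a fin_num.
Proof. exact: (lp_measure_moment0_fin hp hC hmu). Qed.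

(** The recursion at [s = 0] gives [M(p) = M(0)]. *)
Let momentp_fin : moment p p \is a fin_num.
Proof.
by rewrite -[X in moment p X]add0r -moment_by_parts ?lexx ?ler01//
  add0r mul1e moment0_fin.
Qed.

Let moment_fin s : 0 <= s <= p -> moment p s \is a fin_num.
Proof.
move=> /andP[s0 sp]; rewrite ge0_fin_numE ?moment_ge0//.
rewrite (le_lt_trans (moment_le p0 (lexx 0) s0 sp))//.
by rewrite lte_add_pinfty// -ge0_fin_numE ?moment_ge0.
Qed.

(** The order 2 exceeds [p], out of reach of interpolation; the recursion at [s = 2 - p] brings it
    back to an order in [[0, p]]. *)
Let moment2E : moment p 2 = ((3 - p)%:E * moment p (2 - p))%E.
Proof.
move: p1 p2 => ? ?.
rewrite (_ : 3 - p = 2 - p + 1); last by ring.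
rewrite moment_by_parts//; first by rewrite subrK.
by apply/andP; split; lra.
Qed.

Let M' := fine (moment p (2 - p)).

Let M'E : moment p (2 - p) = M'%:E.
Proof.
by move: p1 p2 => ? ?; rewrite fineK// moment_fin//; apply/andP; split; lra.
Qed.

Let M'_gt0 : 0 < M'.
Proof. by move: p2 => ?; rewrite -lte_fin -M'E moment_gt0//; lra. Qed.

Let M2E : moment p 2 = ((3 - p) * M')%:E.
Proof. by rewrite moment2E M'E. Qed.

Let sqr_moment : (\int[lebesgue_measure]_t (t ^+ 2 * exp_power p t)%:E)%E = moment p 2.
Proof.
apply: eq_integral => t _.
by rewrite /power_weight powR_mulrn// real_normK ?num_real.
Qed.

Let pos (t : R) := Num.max t 0.
Let neg (t : R) := Num.max (- t) 0.

Let pos_ge0 t : 0 <= pos t. Proof. by rewrite /pos le_max lexx orbT. Qed.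
Let neg_ge0 t : 0 <= neg t. Proof. by rewrite /neg le_max lexx orbT. Qed.

Let mpos : measurable_fun [set: measurableTypeR R] pos.
Proof. by apply: measurable_funrpos; exact: measurable_id. Qed.
Let mneg : measurable_fun [set: measurableTypeR R] neg.
Proof. by apply: measurable_funrneg; exact: measurable_id. Qed.

Let mexp : measurable_fun [set: measurableTypeR R] (exp_power p).
Proof. exact: measurable_exp_power. Qed.

Let half := (\int[lebesgue_measure]_t (pos t * exp_power p t)%:E)%E.

Let neg_half : (\int[lebesgue_measure]_t (neg t * exp_power p t)%:E)%E = half.
Proof.
rewrite -(@ge0_integral_reflect _ (fun t => neg t * exp_power p t))/=.
- apply: eq_integral => t _; rewrite /neg opprK; congr (_ * _)%:E.
  by rewrite /exp_power normrN.
- exact: measurable_funM.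
- by move=> t; rewrite mulr_ge0 ?expR_ge0.
Qed.

(** Dominated by [M(1)], finite since [1 < p]. Finiteness makes the cancellation in the mean of [f]
    legitimate. *)
Let half_fin : half \is a fin_num.
Proof.
have half0 : (0 <= half)%E.
  by apply: integral_ge0 => t _; rewrite lee_fin mulr_ge0 ?expR_ge0.
rewrite ge0_fin_numE//; apply: (@le_lt_trans _ _ (moment p 1)).
  apply: ge0_le_integral_nonmeasurable => t; rewrite lee_fin.
    by rewrite mulr_ge0 ?expR_ge0.
  rewrite /power_weight powRr1// ler_wpM2r ?expR_ge0//.
  by rewrite /pos ge_max normr_ge0 ler_norm.
rewrite -ge0_fin_numE ?moment_ge0// moment_fin// ler01/=.
exact: ltW.
Qed.

(** The mean of [f] is 0, so its variance is a product of two second moments. For the energy, an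
    upper bound together with nonnegativity suffices to bound the constant from below. *)
Lemma lp_measure_test_function : exists2 q : R, 0 < q &
  [/\ f \in Lfun mu 2%:E,
      Var mu f = (q * ((3 - p) * M') ^+ 2)%:E,
      (0 <= BL_energy (lp_potential p) mu f)%E &
      (BL_energy (lp_potential p) mu f <=
        (2 / (p - 1) * q * (M' * ((3 - p) * M')))%:E)%E].
Proof.
have [q q0 two] := lp_measure_two_coords hp hC hmu.
have msq : measurable_fun [set: measurableTypeR R] (fun t : R => t ^+ 2).
  by apply: measurable_funX; exact: measurable_id.
have mpw : measurable_fun [set: measurableTypeR R] (fun t : R => `|t| `^ (2 - p)).
  by apply: continuous_measurable_fun; apply: continuous_normr_powR; move: p2; lra.
have mf : measurable_fun [set: 'rV[R]_n] f.
  apply: measurable_funM; first exact: (measurable_rV_coord i0).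
  exact: (measurable_rV_coord i1).
have int_sq : (\int[mu]_x (f x ^+ 2)%:E = (q * ((3 - p) * M') ^+ 2)%:E)%E.
  under eq_integral do rewrite /f exprMn.
  rewrite (two (fun t => t ^+ 2) (fun t => t ^+ 2))//; try exact: sqr_ge0.
  by rewrite sqr_moment M2E -!EFinM expr2.
have mcoord (F0 F1 : R -> R) : measurable_fun [set: measurableTypeR R] F0 ->
    measurable_fun [set: measurableTypeR R] F1 ->
    measurable_fun [set: 'rV[R]_n] (fun x => (F0 (x 0 i0) * F1 (x 0 i1))%:E).
  by move=> mF0 mF1; apply/measurable_EFinP; apply: measurable_funM;
    exact: measurable_rV_compose.
(* By reflection, the positive and negative parts of a coordinate both integrate to [half], so the
   positive and negative parts of [f] have the same finite integral. *)
have int_f : (\int[mu]_x (f x)%:E = 0)%E.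
  have fposE x : (fun y => (f y)%:E)^\+%E x =
      ((pos (x 0 i0) * pos (x 0 i1))%:E + (neg (x 0 i0) * neg (x 0 i1))%:E)%E.
    by rewrite funeposE -EFin_max -EFinD /f maxr_mul0.
  have fnegE x : (fun y => (f y)%:E)^\-%E x =
      ((pos (x 0 i0) * neg (x 0 i1))%:E + (neg (x 0 i0) * pos (x 0 i1))%:E)%E.
    by rewrite funenegE -EFinN -EFin_max -EFinD /f -mulrN maxr_mul0 opprK.
  rewrite integralE; under eq_integral do rewrite fposE.
  under [X in (_ - X)%E]eq_integral do rewrite fnegE.
  rewrite !ge0_integralD//; try exact: mcoord;
    try by move=> x _; rewrite lee_fin mulr_ge0.
  rewrite !two// neg_half subee//.
  by rewrite fin_numD !fin_numM.
have [N0 mN] := lp_measure_hyperplanes0 hC hmu.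
set N := [set x : 'rV[R]_n | exists i, x 0 i = 0] in N0 mN.
pose h x := dotr (grad f x *m invmx (hessian (lp_potential p) x)) (grad f x).
(* [g] is a measurable, nonnegative function that agrees with [h] off the coordinate hyperplanes. *)
pose g (x : 'rV[R]_n) := (p - 1)^-1 *
  (`|x 0 i0| `^ (2 - p) * x 0 i1 ^+ 2 + x 0 i0 ^+ 2 * `|x 0 i1| `^ (2 - p)).
have pB1 : 0 < p - 1 by rewrite subr_gt0.
have g0 x : 0 <= g x.
  apply: mulr_ge0; first by rewrite invr_ge0 ltW.
  by rewrite addr_ge0// mulr_ge0 ?powR_ge0 ?sqr_ge0.
have hg x : ~ N x -> h x = g x.
  move=> xN; have x0 i : x 0 i != 0 by apply/eqP => xi0; apply: xN; exists i.
  rewrite /h BL_integrand ?gt_eqF//; last by move: p1; lra.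
  rewrite /g grad_coord_prod//; congr (_ * _).
  rewrite !big_ord_recl big1 ?addr0; last first.
    by move=> i _; rewrite !mxE/= !mulr0 addr0 expr0n mulr0.
  by rewrite !mxE/= !mulr1 !mulr0 addr0 add0r [X in _ + X]mulrC.
have mg1 := mcoord _ _ mpw msq.
have mg2 := mcoord _ _ msq mpw.
have gE x : (g x)%:E = ((p - 1)^-1%:E * ((`|x 0 i0| `^ (2 - p) * x 0 i1 ^+ 2)%:E +
    (x 0 i0 ^+ 2 * `|x 0 i1| `^ (2 - p))%:E))%E by rewrite -EFinD -EFinM.
have mg : measurable_fun [set: 'rV[R]_n] (fun x => (g x)%:E).
  under eq_fun do rewrite gE.
  by apply: measurable_funeM; exact: emeasurable_funD.
have int_g : (\int[mu]_x (g x)%:E =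
    (2 / (p - 1) * q * (M' * ((3 - p) * M')))%:E)%E.
  under eq_integral do rewrite gE.
  have g1_0 x : (0 <= (`|x 0 i0| `^ (2 - p) * x 0 i1 ^+ 2)%:E)%E.
    by rewrite lee_fin mulr_ge0 ?powR_ge0 ?sqr_ge0.
  have g2_0 x : (0 <= (x 0 i0 ^+ 2 * `|x 0 i1| `^ (2 - p))%:E)%E.
    by rewrite lee_fin mulr_ge0 ?powR_ge0 ?sqr_ge0.
  rewrite ge0_integralZl//; last 3 first.
  - exact: emeasurable_funD.
  - by move=> x _; rewrite adde_ge0.
  - by rewrite lee_fin invr_ge0 ltW.
  rewrite ge0_integralD//.
  rewrite (two _ _ mpw msq (fun=> powR_ge0 _ _) (fun=> sqr_ge0 _)).
  rewrite (two _ _ msq mpw (fun=> sqr_ge0 _) (fun=> powR_ge0 _ _)).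
  rewrite sqr_moment M2E -/(moment p (2 - p)) M'E -!EFinM.
  by congr EFin; ring.
(* The default values of [h] on [N] may be negative, so its negative part is first shown to
   integrate to 0. *)
have hneg : (\int[mu]_x (fun y => (h y)%:E)^\-%E x = 0)%E.
  apply/eqP; rewrite eq_le; apply/andP; split; last first.
    by apply: integral_ge0 => x _; exact: funeneg_ge0.
  rewrite -[leRHS](integral0 mu setT).
  apply: (ge0_le_integral_off_null mN N0) => //.
  move=> x xN; rewrite funenegE hg// -EFinN -EFin_max lee_fin ge_max lexx andbT.
  by rewrite oppr_le0.
have BLE : BL_energy (lp_potential p) mu f = (\int[mu]_x (fun y => (h y)%:E)^\+%E x)%E.
  by rewrite /BL_energy integralE hneg sube0.
exists q => //; split.
- rewrite inE; apply/andP; split; rewrite inE/= //.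
  rewrite /finite_norm unlock poweR_lty//.
  rewrite (eq_integral (fun x => (f x ^+ 2)%:E)) ?int_sq ?ltry// => x _.
  by rewrite /= powR_mulrn// real_normK ?num_real.
- by rewrite /Var int_sq int_f expe2 mul0e sube0.
- by rewrite BLE; apply: integral_ge0 => x _; exact: funepos_ge0.
- rewrite BLE -int_g; apply: (ge0_le_integral_off_null mN N0) => //.
  by move=> x xN; rewrite funeposE hg// -EFin_max lee_fin ge_max lexx g0.
Qed.

Lemma lp_potential_best_even_BL :
  ((1 - p^-1)%:E < best_even_BL (lp_potential p) mu)%E.
Proof.
have [q q0 [fL VarE E0 Ele]] := lp_measure_test_function.
have pB1 : 0 < p - 1 by rewrite subr_gt0.
have c0 : 0 < 3 - p by move: p2; lra.
apply: (@lt_le_trans _ _ ((3 - p) * (p - 1) / 2)%:E).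
  rewrite lte_fin -subr_gt0.
  (* This rests on [p(3 - p) - 2 = (p - 1)(2 - p)]. *)
  rewrite [X in 0 < X](_ : _ = (p - 1) * ((p - 1) * (2 - p)) / (2 * p)); last first.
    by field; move: p1; lra.
  by rewrite divr_gt0 ?mulr_gt0 ?subr_gt0//; move: p1; lra.
apply: le_ereal_inf_tmp => _ [lambda lambdaP <-]; rewrite lee_fin.
have fC1 : C1_fun f by exact: C1_coord_prod.
have feven : even_fun f by move=> x; rewrite /f !mxE mulrNN.
have := lambdaP f fC1 feven fL; rewrite VarE.
have Efin : BL_energy (lp_potential p) mu f \is a fin_num.
  by rewrite ge0_fin_numE// (le_lt_trans Ele)// ltry.
rewrite -(fineK Efin) -EFinM lee_fin.
move: E0 Ele; rewrite -(fineK Efin) !lee_fin/=; set E := fine _ => E0 Ele VE.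
have V0 : 0 < q * ((3 - p) * M') ^+ 2 by rewrite mulr_gt0// exprn_gt0// mulr_gt0.
(* Positivity of [lambda], forced by that of the variance, allows the energy to be replaced by its
   upper bound. *)
have l0 : 0 < lambda.
  rewrite ltNge; apply/negP => l0; move: V0; rewrite ltNge => /negP; apply.
  by rewrite (le_trans VE)// mulr_le0_ge0.
have : q * ((3 - p) * M') ^+ 2 <= lambda * (2 / (p - 1) * q * (M' * ((3 - p) * M'))).
  by rewrite (le_trans VE)// ler_pM2l.
rewrite [leLHS](_ : _ = (3 - p) * (p - 1) / 2 *
    (2 / (p - 1) * q * (M' * ((3 - p) * M')))); last first.
  by field; rewrite gt_eqF.
by rewrite ler_pM2r// !mulr_gt0// invr_gt0.
Qed.

End lp_measure_inequality.

(** * Chains of boxes along a diagonal, and a Lipschitz bound for powers *)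

Lemma diagonal_boxes (R : realType) (m N : nat) (a w l : R)
    (A : nat -> set (measurableTypeR R)) (D : set (measurableTypeR R)) :
  0 < w -> 0 <= l ->
  (forall k, measurable (A k)) -> (forall k, lebesgue_measure (A k) = w%:E) ->
  measurable D -> lebesgue_measure D = l%:E ->
  exists S : set 'rV[R]_m.+2, [/\ measurable S,
    lebesgue_rV R m.+2 S = (N%:R * (w * (w * l ^+ m)))%:E &
    forall x, S x -> exists2 k, (k < N)%N &
      [/\ A k (x 0 ord0),
          `[a + k%:R * w, a + k.+1%:R * w[%classic (x 0 (lift ord0 ord0)) &
          forall i, D (x 0 (lift ord0 (lift ord0 i)))]].
Proof.
move=> w0 l0 mA lA mD lD.
pose B k : set (measurableTypeR R) := `[a + k%:R * w, a + k.+1%:R * w[%classic.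
have mB k : measurable (B k) by exact: measurable_itv.
have lB k : lebesgue_measure (B k) = w%:E.
  rewrite lebesgue_measure_itv/= lte_fin ltrD2l ltr_pM2r// ltr_nat ltnSn.
  by rewrite -EFinD; congr EFin; rewrite -natr1; ring.
(* The kth box has sides [A k], [B k], and [D] repeated [m] times. The consecutive half-open
   intervals [B k] already make the boxes disjoint; the [A k] are left free because the chain rises
   for the tube and descends for the dual slab. *)
pose Q (k : nat) (i : 'I_m.+2) :=
  if i == ord0 then A k else if i == lift ord0 ord0 then B k else D.
have mQ k i : measurable (Q k i) by rewrite /Q; case: ifP => // _; case: ifP.
pose F (k : nat) := [set x : 'rV[R]_m.+2 | forall i, Q k i (x 0 i)].
have mF k : measurable (F k).
  rewrite (_ : F k = \bigcap_(i in [set: 'I_m.+2]) (@rV_coord R m.+2 i @^-1` Q k i)).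
    apply: fin_bigcap_measurable => // i _.
    by rewrite -[X in measurable X]setTI; exact: measurable_rV_coord.
  by apply/seteqP; split => x /= xQ i; [move=> _|]; exact: xQ.
have mUF : measurable (\big[setU/set0]_(k < N) F k) by exact: bigsetU_measurable.
have FB k x : F k x -> B k (x 0 (lift ord0 ord0)) by move=> /(_ (lift ord0 ord0)).
have B_le i j t : (i < j)%N -> B i t -> B j t -> False.
  rewrite /B /= !in_itv/= => ij /andP[_ ti] /andP[tj _].
  have : a + i.+1%:R * w <= a + j%:R * w by rewrite lerD2l ler_pM2r// ler_nat.
  by move: (le_lt_trans tj ti); rewrite ltNge => /negP.
exists (\big[setU/set0]_(k < N) F k); split => //.
- rewrite measure_semi_additive_ord//; last first.
    move=> i j _ _ [x [/FB xi /FB xj]]; apply: val_inj.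
    have [ij|ij|//] := ltngtP i j; first by case: (B_le _ _ _ ij xi xj).
    by case: (B_le _ _ _ ij xj xi).
  have vF k : lebesgue_rV R m.+2 (F k) = (w * (w * l ^+ m))%:E.
    rewrite /F lebesgue_rV_box; last exact: mQ.
    rewrite !big_ord_recl /Q/= lA lB (eq_bigr (fun=> l%:E)) => [|i _]; last first.
      by rewrite lD.
    by rewrite prodEFin prodr_const card_ord -!EFinM.
  rewrite (eq_bigr (fun=> (w * (w * l ^+ m))%:E)) => [|k _]; last exact: vF.
  by rewrite sumEFin sumr_const card_ord mulr_natl.
- move=> x; rewrite -bigcup_mkord => -[k /= kN Fx]; exists k => //; split.
  + exact: (Fx ord0).
  + exact: FB.
  + by move=> i; have := Fx (lift ord0 (lift ord0 i)).
Qed.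

(** With [r = a / b >= 1] one has [r^s <= r], so the difference is at most
    [(r - 1) b^s <= r - 1 = (a - b) / b]. Staying above 1/2 avoids the origin, near which [t^s] is
    not Lipschitz for [0 < s < 1]. *)
Lemma powR_lipschitz_half (R : realType) (s a b : R) : 0 <= s <= 1 ->
  2^-1 <= b -> b <= a -> a <= 1 -> a `^ s - b `^ s <= 2 * (a - b).
Proof.
move=> /andP[s0 s1] b2 ba a1; have b0 : 0 < b by lra.
have ab : a `^ s <= (a / b) * b `^ s.
  have ab0 : 0 <= a / b by rewrite divr_ge0//; lra.
  rewrite -{1}(divfK (lt0r_neq0 b0) a) (powRM _ ab0 (ltW b0)).
  by rewrite ler_wpM2r ?powR_ge0// ler1_powR// ler_pdivlMr// mul1r.
have bs1 : b `^ s <= 1.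
  by rewrite -(powRr0 b) ger_powR//; apply/andP; split; lra.
have abb : (a / b - 1) <= 2 * (a - b).
  have -> : a / b - 1 = (a - b) / b by rewrite mulrBl divff ?gt_eqF.
  rewrite ler_pdivrMr// mulrAC.
  by rewrite ler_peMl ?subr_ge0//; lra.
have ab1 : 0 <= a / b - 1 by rewrite subr_ge0 ler_pdivlMr// mul1r.
apply: le_trans abb; rewrite lerBlDr (le_trans ab)//.
rewrite -lerBlDr -{2}(mul1r (b `^ s)) -mulrBl.
by rewrite -[leRHS]mulr1 ler_wpM2l.
Qed.

(** * The tube around the diagonal and its support function *)

Section tube.
Context {R : realType} {m : nat}.
Local Notation n := m.+2.
Local Notation i0 := (ord0 : 'I_n).
Local Notation i1 := (lift ord0 ord0 : 'I_n).

Definition tube (N : R) := [set x : 'rV[R]_n |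
  [/\ `|x 0 i1 - x 0 i0| <= 1, `|x 0 i0| <= N &
      forall i, `|x 0 (lift ord0 (lift ord0 i))| <= 1]].

(** The indicator of convex analysis: [exp(-Phi)] integrates to the volume of the tube, and the
    Legendre transform is the support function. *)
Definition tube_indicator (N : R) (x : 'rV[R]_n) : \bar R :=
  if x \in tube N then 0%E else +oo%E.

Variables (N : R) (N0 : 0 < N).

Let tube_in x : tube N x -> tube_indicator N x = 0%E.
Proof. by move=> xN; rewrite /tube_indicator mem_set. Qed.

Let tube_notin x : ~ tube N x -> tube_indicator N x = +oo%E.
Proof. by move=> xN; rewrite /tube_indicator memNset. Qed.

Let tube_indicator_ge0 x : (0 <= tube_indicator N x)%E.
Proof. by rewrite /tube_indicator; case: ifP. Qed.

Lemma proper_tube_indicator : proper_fun (tube_indicator N).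
Proof.
split=> [x|]; first by rewrite /tube_indicator; case: ifP.
exists 0; rewrite tube_in//; split; rewrite ?mxE ?subrr ?normr0//.
- exact: ltW.
- by move=> i; rewrite mxE normr0.
Qed.

Lemma even_tube_indicator : even_fun (tube_indicator N).
Proof.
have tubeN x : tube N x -> tube N (- x).
  move=> [x01 x0 xi]; split; rewrite ?mxE ?normrN//.
  - by rewrite -opprD normrN.
  - by move=> i; rewrite mxE normrN.
move=> x; have [xN|xN] := pselect (tube N x).
  by rewrite !tube_in//; exact: tubeN.
by rewrite !tube_notin// => /tubeN; rewrite opprK.
Qed.

Let norm_convex (t a b c : R) : 0 <= t <= 1 -> `|a| <= c -> `|b| <= c ->
  `|t * a + (1 - t) * b| <= c.
Proof.
move=> /andP[t0 t1] ac bc; rewrite (le_trans (ler_normD _ _))// !normrM.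
rewrite (ger0_norm t0) (@ger0_norm _ (1 - t)) ?subr_ge0//.
rewrite [leRHS](_ : c = t * c + (1 - t) * c); last by ring.
by rewrite lerD// ler_wpM2l// subr_ge0.
Qed.

Lemma convex_tube_indicator : econvex_fun (tube_indicator N).
Proof.
move=> x y t t01; have /andP[t0 t1] := t01.
(* The endpoints are treated apart because [0 * +oo] is 0; for [t] strictly between, a point off the
   tube makes the right-hand side +oo. *)
have [->|t'0] := eqVneq t 0.
  by rewrite scale0r add0r subr0 scale1r mul0e add0e mul1e.
have [->|t'1] := eqVneq t 1.
  by rewrite subrr scale0r addr0 scale1r mul0e adde0 mul1e.
have tp : (0 < t%:E)%E by rewrite lte_fin lt0r t'0.
have t1p : (0 < (1 - t)%:E)%E by rewrite lte_fin subr_gt0 lt_neqAle t'1.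
have [xN|xN] := pselect (tube N x); last first.
  rewrite (tube_notin xN) gt0_muley// addye ?leey//.
  by rewrite gt_eqF// (lt_le_trans (ltNyr 0))// mule_ge0// ltW.
have [yN|yN] := pselect (tube N y); last first.
  by rewrite (tube_notin yN) (tube_in xN) mule0 add0e gt0_muley ?leey.
rewrite tube_in ?mule_ge0//; first by rewrite adde_ge0// mule_ge0// ltW.
move: xN yN => [x01 x0 xi] [y01 y0 yi]; split.
- rewrite !mxE [X in `|X|](_ : _ = t * (x 0 i1 - x 0 i0) +
    (1 - t) * (y 0 i1 - y 0 i0)); last by ring.
  exact: norm_convex.
- by rewrite !mxE; exact: norm_convex.
- by move=> i; rewrite !mxE; exact: norm_convex.
Qed.

(** In the pairing, the long coordinate [z 0 i0] multiplies only [y 0 i0 + y 0 i1], which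
    contributes at most [N * N^-1]; the transverse part [z 0 i1 - z 0 i0] and each other coordinate
    contribute at most 1. *)
Lemma legendre_tube_le (y : 'rV[R]_n) :
  (forall i, `|y 0 i| <= 1) -> `|y 0 i0 + y 0 i1| <= N^-1 ->
  (legendre (tube_indicator N) y <= (m.+2%:R)%:E)%E.
Proof.
move=> y1 y01; apply: ge_ereal_sup => _ [z _ <-].
have [zN|zN] := pselect (tube N z); last first.
  by rewrite (tube_notin zN) addeNy// leNye.
rewrite (tube_in zN) sube0 lee_fin /dotr !big_ord_recl.
case: zN => [z01 z0 zi].
have mul_le1 (a b c d : R) : `|a| <= c -> `|b| <= d -> a * b <= c * d.
  by move=> ac bd; rewrite (le_trans (ler_norm _))// normrM ler_pM.
rewrite addrA [X in X + _](_ : _ =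
  z 0 i0 * (y 0 i0 + y 0 i1) + (z 0 i1 - z 0 i0) * y 0 i1); last by ring.
have -> : m.+2%:R = m%:R + 2%:R :> R by rewrite -natrD addn2.
rewrite addrC lerD//.
  rewrite -[leRHS](_ : \sum_(i < m) 1 = _); last by rewrite sumr_const card_ord.
  by apply: ler_sum => i _; rewrite -[leRHS]mul1r mul_le1.
rewrite (_ : 2%:R = N * N^-1 + 1 * 1 :> R); last by rewrite mulfV ?gt_eqF// mulr1.
by rewrite lerD// mul_le1.
Qed.

End tube.

(** * Volume bounds for the tube and the dual slab *)

Section tube_santalo.
Context {R : realType} {m : nat}.
Local Notation n := m.+2.
Local Notation i0 := (ord0 : 'I_n).
Local Notation i1 := (lift ord0 ord0 : 'I_n).
Variables (N : nat) (N_gt0 : (0 < N)%N).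

Let NR : 0 < N%:R :> R. Proof. by rewrite ltr0n. Qed.

Lemma tube_volume_ge :
  ((N%:R * 2 ^+ m)%:E <=
   \int[lebesgue_rV R n]_x expeR (- tube_indicator N%:R x))%E.
Proof.
(* The tube contains the [N] unit squares on the diagonal, times [[-1, 1]^m]. *)
pose A k : set (measurableTypeR R) := `[k%:R, k.+1%:R[%classic.
pose D : set (measurableTypeR R) := `[(-1), 1]%classic.
have lA k : lebesgue_measure (A k) = 1%:E.
  by rewrite lebesgue_measure_itv/= lte_fin ltr_nat ltnSn -EFinD -natr1 addrAC subrr add0r.
have lD : lebesgue_measure D = 2%:E.
  by rewrite lebesgue_measure_itv/= lte_fin ifT -?EFinB ?opprK//; lra.
have [S [mS vS SP]] := @diagonal_boxes R m N 0 1 2 A D ltr01 (ler0n _ _)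
  (fun=> measurable_itv _) lA (measurable_itv _) lD.
have -> : (N%:R * 2 ^+ m)%:E = (1%:E * lebesgue_rV R n S)%E.
  by rewrite vS mul1e !mul1r.
apply: ge0_measure_le_integral => // [x|x /SP [k kN [Ax Bx Dx]]].
  exact: expeR_ge0.
rewrite /tube_indicator mem_set ?oppe0 ?expeR0//.
move: Ax Bx; rewrite /A/= !in_itv/= !mulr1 !add0r => /andP[a1 a2] /andP[b1 b2].
rewrite -natr1 in a2 b2; have k0 : 0 <= k%:R :> R by [].
have kN1 : k%:R + 1 <= N%:R :> R by rewrite natr1 ler_nat.
split.
- by rewrite ler_norml; apply/andP; split; lra.
- by rewrite ler_norml; apply/andP; split; lra.
- by move=> i; have := Dx i; rewrite /D/= in_itv/= ler_norml.
Qed.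

(** On boxes with [x 0 i0] negative, [x 0 i1] positive and nearly equal moduli, the first two
    gradient entries almost cancel, which keeps the support function bounded by [m.+2]. *)
Lemma tube_dual_volume_ge (p : R) : 1 < p < 2 ->
  ((expR (- ((p - 1)^-1 * m.+2%:R)) * (2^-1 ^+ m / 4) / N%:R)%:E <=
   \int[lebesgue_rV R n]_x expeR (- ((p - 1)^-1%:E *
     legendre (tube_indicator N%:R) (grad (lp_potential p) x))))%E.
Proof.
(* With this width, [N] boxes exactly fill the moduli from 1/2 to 1, and the Lipschitz constant 2
   turns a gap [w] between moduli into [2 w = 1 / N]. *)
move=> /andP[p1 p2]; pose w : R := (2 * N%:R)^-1.
have w0 : 0 < w by rewrite invr_gt0 mulr_gt0.
have Nw : N%:R * w = 2^-1 by rewrite /w; field; rewrite gt_eqF.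
have w2 : 2 * w = N%:R^-1 by rewrite /w; field; rewrite gt_eqF.
pose A k : set (measurableTypeR R) :=
  `](- (2^-1 + k.+1%:R * w)), (- (2^-1 + k%:R * w))]%classic.
pose D : set (measurableTypeR R) := `[2^-1, 1]%classic.
have lA k : lebesgue_measure (A k) = w%:E.
  rewrite lebesgue_measure_itv/= lte_fin ltrN2 ltrD2l ltr_pM2r// ltr_nat ltnSn.
  by rewrite -EFinD; congr EFin; rewrite -natr1; ring.
have lD : lebesgue_measure D = 2^-1%:E.
  rewrite lebesgue_measure_itv/= lte_fin invf_lt1// ltr1n -EFinB.
  by congr EFin; field.
have h0 : 0 <= 2^-1 :> R by rewrite invr_ge0.
have [S [mS vS SP]] := @diagonal_boxes R m N 2^-1 w 2^-1 A D w0 h0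
  (fun=> measurable_itv _) lA (measurable_itv _) lD.
rewrite [leLHS](_ : _ = ((expR (- ((p - 1)^-1 * m.+2%:R)))%:E *
    lebesgue_rV R n S)%E); last first.
  rewrite vS -EFinM; congr EFin; rewrite mulrA Nw -mulrA; congr (_ * _).
  by rewrite /w; field; rewrite gt_eqF.
apply: ge0_measure_le_integral => // [x|x /SP [k kN [Ax Bx Dx]]].
- exact: expeR_ge0.
have kw0 : 0 <= k%:R * w by rewrite mulr_ge0// ltW.
have kw1 : k%:R * w + w <= 2^-1.
  by rewrite -Nw -[X in _ + X]mul1r -mulrDl ler_pM2r// natr1 ler_nat.
move: Ax Bx; rewrite /A/= !in_itv/= -(natr1 k) mulrDl mul1r => /andP[a1 a2] /andP[b1 b2].
have abs0 : `|x 0 i0| = - x 0 i0 by rewrite ltr0_norm//; lra.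
have abs1 : `|x 0 i1| = x 0 i1 by rewrite gtr0_norm//; lra.
have sg0 : Num.sg (x 0 i0) = -1 by rewrite ltr0_sg//; lra.
have sg1 : Num.sg (x 0 i1) = 1 by rewrite gtr0_sg//; lra.
have absP i : 2^-1 <= `|x 0 i| <= 1.
  have [->|[->|[j ->]]] : i = i0 \/ i = i1 \/ exists j, i = lift ord0 (lift ord0 j).
    case: (unliftP i0 i) => [j ->|->]; last by left.
    right; case: (unliftP ord0 j) => [k' ->|->]; last by left.
    by right; exists k'.
  - by rewrite abs0; apply/andP; split; lra.
  - by rewrite abs1; apply/andP; split; lra.
  - have := Dx j; rewrite /D/= in_itv/= => /andP[d1 d2].
    by rewrite ger0_norm ?d1//; lra.
have x_neq0 i : x 0 i != 0.
  by rewrite -normr_gt0; have /andP[] := absP i; lra.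
rewrite -[leLHS]/(expeR (- ((p - 1)^-1 * m.+2%:R)%:E)%E) lee_expeR leeN2 EFinM.
have pB1 : 0 < p - 1 by rewrite subr_gt0.
apply: lee_wpmul2l; first by rewrite lee_fin invr_ge0 ltW.
rewrite grad_lp_potential//; last by lra.
apply: legendre_tube_le => // [i|]; rewrite !mxE /signed_powR.
  rewrite normrM normr_sg x_neq0 mul1r ger0_norm ?powR_ge0//.
  have /andP[lo hi] := absP i.
  rewrite -[leRHS](powRr0 `|x 0 i|); apply: ger_powR; last by lra.
  by rewrite hi andbT; lra.
rewrite sg0 sg1 mulN1r mul1r addrC.
have s01 : 0 <= p - 1 <= 1 by apply/andP; split; lra.
have /andP[lo0 hi0] := absP i0; have /andP[lo1 hi1] := absP i1.
have xw : `|x 0 i1| - `|x 0 i0| < w by lra.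
have xw' : `|x 0 i0| - `|x 0 i1| < w by lra.
rewrite -w2.
have [le10|/ltW le01] := leP `|x 0 i0| `|x 0 i1|.
  rewrite ger0_norm; last by rewrite subr_ge0 ge0_ler_powR ?nnegrE// ltW.
  by rewrite (le_trans (powR_lipschitz_half s01 lo0 le10 hi1))// ler_pM2l// ltW.
rewrite distrC ger0_norm; last by rewrite subr_ge0 ge0_ler_powR ?nnegrE// ltW.
by rewrite (le_trans (powR_lipschitz_half s01 lo1 le01 hi0))// ler_pM2l// ltW.
Qed.

(** The volume of order [N] times the power [p - 1] of a dual integral of order at least [1 / N]
    leaves [N^(2 - p)]. *)
Lemma tube_santalo_bound (p I : R) : 1 < p < 2 -> 0 <= I ->
  (\int[lebesgue_rV R n]_x (expR (- lp_potential p x))%:E = I%:E)%E ->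
  santalo_ineq p (lp_potential p) (@tube_indicator R m N%:R) ->
  2 ^+ m * (expR (- ((p - 1)^-1 * m.+2%:R)) * (2^-1 ^+ m / 4)) `^ (p - 1) *
    N%:R `^ (2 - p) <= I `^ p.
Proof.
move=> hp I0 IE; rewrite /santalo_ineq IE poweR_EFin.
set c := _ * (_ / 4); have c0 : 0 <= c.
  by rewrite mulr_ge0 ?expR_ge0// divr_ge0// exprn_ge0// invr_ge0.
move=> le; rewrite -lee_fin; apply: le_trans le.
rewrite [leLHS](_ : _ = ((N%:R * 2 ^+ m)%:E * poweR (c / N%:R)%:E (p - 1))%E).
  apply: lee_pmul.
  - by rewrite lee_fin mulr_ge0// exprn_ge0.
  - by rewrite poweR_ge0.
  - exact: tube_volume_ge.
  - apply: gt0_ler_poweR; rewrite ?in_itv/= ?leey ?andbT.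
    + by case/andP: hp => ? ?; lra.
    + by rewrite lee_fin divr_ge0.
    + by apply: integral_ge0 => x _; exact: expeR_ge0.
    + exact: tube_dual_volume_ge.
rewrite poweR_EFin -EFinM; congr EFin.
rewrite (@powRM _ c N%:R^-1) ?invr_ge0 ?ler0n//.
rewrite (_ : 2 - p = 1 - (p - 1)); last by ring.
rewrite (@powRB _ N%:R 1) ?powRr1 ?ler0n ?(gt_eqF NR) ?implybT//.
rewrite (_ : N%:R^-1 `^ (p - 1) = (N%:R `^ (p - 1))^-1); last first.
  by rewrite -powR_inv1// -powRrM -[in RHS]powR_inv1 ?powR_ge0// -powRrM mulrC.
by ring.
Qed.

End tube_santalo.

(** * Normalization and the choice of the tube length *)

Lemma integral_exp_lp_potential (R : realType) (n : nat) (p C : R)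
    (mu : probability 'rV[R]_n R) : 0 < p -> 0 < C ->
  (forall A, measurable A -> mu A =
    (\int[lebesgue_rV R n]_(x in A) (C * expR (- lp_potential p x))%:E)%E) ->
  (\int[lebesgue_rV R n]_x (expR (- lp_potential p x))%:E = C^-1%:E)%E.
Proof.
move=> p0 C0 hmu; have := hmu setT measurableT; rewrite probability_setT.
under eq_integral do rewrite EFinM.
rewrite ge0_integralZl//; last 2 first.
- by apply/measurable_EFinP; exact: measurable_expR_lp_potential.
- by rewrite lee_fin ltW.
move=> CI; rewrite -[LHS]mul1e -(mulVf (lt0r_neq0 C0)) EFinM -muleA -CI mule1//.
Qed.

Theorem proposition1p9 (R : realType) (n : nat) (hn : (1 < n)%N)
    (p : R) (hp : 1 < p < 2)
    (C : R) (hC : 0 < C) (mu : probability 'rV[R]_n R)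
    (hmu : forall A : set 'rV[R]_n, measurable A ->
      mu A = (\int[lebesgue_rV R n]_(x in A)
                (C * expR (- lp_potential p x))%:E)%E) :
  ((1 - p^-1)%:E < best_even_BL (lp_potential p) mu)%E /\
  ~ (forall Phi : 'rV[R]_n -> \bar R,
       proper_fun Phi -> econvex_fun Phi -> even_fun Phi ->
       santalo_ineq p (lp_potential p) Phi).
Proof.
case: n hn mu hmu => [|[|m]] // _ nu hnu; have /andP[p1 p2] := hp.
split; first exact: (lp_potential_best_even_BL hp hC hnu).
move=> santalo.
pose K := 2 ^+ m * (expR (- ((p - 1)^-1 * m.+2%:R)) * (2^-1 ^+ m / 4)) `^ (p - 1).
have K0 : 0 < K.
  by rewrite mulr_gt0 ?exprn_gt0// powR_gt0// mulr_gt0 ?expR_gt0// divr_gt0.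
have C'0 : 0 <= C^-1 by rewrite invr_ge0 ltW.
(* [b] solves [K b^(2 - p) = C^(-p)], the case of equality in the bound, so any integer [N > b]
   violates it. *)
pose b := (C^-1 `^ p / K) `^ (2 - p)^-1.
pose N := (Num.bound b).
have bN : b < N%:R by apply: archi_boundP; exact: powR_ge0.
have N0 : (0 < N)%N by rewrite -(ltr0n R) (le_lt_trans (powR_ge0 _ _) bN).
have NR : 0 < N%:R :> R by rewrite ltr0n.
have p0 : 0 < p by lra.
have := tube_santalo_bound N0 hp C'0 (integral_exp_lp_potential p0 hC hnu)
  (santalo _ (proper_tube_indicator NR) (convex_tube_indicator _)
     (even_tube_indicator _)).
rewrite -/K leNgt => /negP; apply.
rewrite mulrC -ltr_pdivrMr//.
have q0 : 0 < 2 - p by rewrite subr_gt0.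
have := gt0_ltr_powR q0 _ _ bN; rewrite !nnegrE powR_ge0 ler0n => /(_ isT isT).
by rewrite /b -powRrM mulVf ?gt_eqF// powRr1// divr_ge0 ?powR_ge0// ltW.
Qed.
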